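(* Let $k$ be a field of characteristic $0$ and let $D\in\mathcal{J}=k((z))[x_0,x_1,x_2,\dots]$. Then the residue pairing endows the derived space of solutions $\operatorname{dSol}(\delta D)$ of the equation $\delta D=0$, where $\delta$ is the variational derivative, with a Tate $(-1)$-symplectic form.
   Context: Notation. $\mathcal{K}=k((z))$. $\mathcal{J}=\mathcal{K}[x_0,x_1,\dots]$ is the differential algebra with derivation $\partial_z$ acting on $\mathcal{K}$ as $d/dz$ and by $\partial_z x_i=x_{i+1}$; $x_i$ stands for $y^{(i)}(z)$. Put $\partial_i=\partial/\partial x_i$. The variational derivative is $\delta=\sum_i(-1)^i\partial_z^i\partial_i:\mathcal{J}\to\mathcal{J}$. Loop space. $\mathcal{L}\mathbb{A}^1=\operatorname{colim}_n\operatorname{Spec}k[y_i\mid i\ge -n]$ is the ind-affine scheme whose $A$-points are $A((z))$; its topological algebra of functions is $\mathcal{O}(\mathcal{L}\mathbb{A}^1)=\lim_n k[y_i\mid i\ge -n]$. Put $y(z)=\sum_{i\in\mathbb{Z}}y_iz^i$. For $E\in\mathcal{J}$, $E_i\in\mathcal{O}(\mathcal{L}\mathbb{A}^1)$ denotes the $z^i$-coefficient of $E(z,y(z),y'(z),\dots)$. Derived solution space. For $E\in\mathcal{J}$, $\operatorname{dSol}(E)$ is the derived ind-scheme obtained as the homotopy fibre over $0$ of the map $\mathcal{L}\mathbb{A}^1\to\mathcal{L}\mathbb{A}^1$ with components $(E_i)_{i\in\mathbb{Z}}$. It is modelled by the topological commutative differential graded algebra freely topologically generated by $y_i$ ($i\in\mathbb{Z}$)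 in degree $0$ and $\xi_j$ ($j\in\mathbb{Z}$) in degree $-1$, with differential $\xi_j\mapsto E_j$; that is, the limit over $n$ of the algebras generated by $y_i$, $i\ge -n$, and $\xi_j$, $j\ge -m(n)$, where $m(n)$ is nondecreasing in $n$, tends to infinity, and is such that $E_j$ vanishes in $k[y_i\mid i\ge -n]$ for $j<-m(n)$. Tate symplectic forms. A derived ind-scheme $X$ is Tate if its cotangent complex $\mathbb{L}_X\in\mathbf{Pro}(QC(X))$ lies in the self-dual subcategory $\mathbf{Tate}(X)$ of Tate sheaves, so that $\mathbb{T}_X$ is the dual of $\mathbb{L}_X$; $\operatorname{dSol}(E)$ is Tate. A Tate $(-1)$-symplectic form on such $X$ is a closed $2$-form of degree $-1$ whose underlying $2$-form is non-degenerate, i.e. induces an equivalence $\mathbb{T}_X\cong\mathbb{L}_X[-1]$. Residue pairing. It is the pairing $(f,g)\mapsto\int fg\,dz:=\operatorname{res}_0(fg\,dz)$. That it endows $\operatorname{dSol}(E)$ with a Tate $(-1)$-symplectic form means that the form $\omega_{\int}=\sum_{i\in\mathbb{Z}}dy_i\,d\xi_{-1-i}$, which pairs the degree $0$ generators $\partial_{y_i}\leftrightarrow z^i$ and the degree $1$ generators $\partial_{\xi_j}\leftrightarrow z^j$ of the tangent complex by the residue pairing, is a Tate $(-1)$-symplectic form on $\operatorname{dSol}(E)$ (in particular closed for the internal differential). *)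

(* Defs.v *)
From HB Require Import structures.
From mathcomp Require Import all_boot all_order all_algebra finmap.
From mathcomp Require Import monalg.
From mathcomp Require Import mathcomp_extra boolp classical_sets functions.
From mathcomp Require Import cardinality fsbigop.
From mathcomp Require Import zify ring.
Set Implicit Arguments.
Unset Strict Implicit.
Unset Printing Implicit Defensive.
Import Order.TTheory GRing.Theory Num.Theory.
Local Open Scope ring_scope.
Local Open Scope classical_set_scope.

Lemma fsbigT_seq (V : nmodType) (T : choiceType) (r : seq T) (F : T -> V) :
  uniq r -> (forall i, i \notin r -> F i = 0) ->
  \sum_(i \in setT) F i = \sum_(i <- r) F i.
Proof.
move=> ur Fr; rewrite (@fsbigE _ _ _ _ setT r) //; last by move=> i _ /Fr.
by under eq_bigl do rewrite in_setT.
Qed.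

Section LaurentZmod.
Context (R : zmodType).

Definition bounded_below : {pred int -> R} :=
  fun f => `[< exists N : int, forall i, i < N -> f i = 0 >].

Record laurent := Laurent {
  lcoef :> int -> R;
  lcoefP : lcoef \in bounded_below }.

Lemma bounded_below_zmod : zmod_closed bounded_below.
Proof.
split; first by apply/asboolP; exists 0.
move=> f g /asboolP[N fN] /asboolP[M gM]; apply/asboolP.
exists (Num.min N M) => i; rewrite lt_min => /andP[iN iM].
by rewrite !fctE fN // gM // subrr.
Qed.

HB.instance Definition _ :=
  GRing.isZmodClosed.Build (int -> R) bounded_below bounded_below_zmod.
HB.instance Definition _ := [isSub for lcoef].
HB.instance Definition _ := [Choice of laurent by <:].
HB.instance Definition _ := [SubChoice_isSubZmodule of laurent by <:].

Lemma laurentP (f g : laurent) : f =1 g -> f = g.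
Proof. by move=> fg; apply: val_inj; apply: funext. Qed.

Lemma laurent_bound (f : laurent) :
  exists M : nat, forall i : int, i < - M%:Z -> f i = 0.
Proof.
case: f => f /= /asboolP[N fN]; exists `|N|%N => i iN; apply: fN; lia.
Qed.

End LaurentZmod.

Section LaurentRing.
Context (R : comNzRingType).
Implicit Types f g h : laurent R.

Definition conv (a b : nat -> R) (t : nat) : R :=
  \sum_(s < t.+1) a s * b (t - s)%N.

Lemma convE (a b : nat -> R) K t : (t < K)%N ->
  conv a b t = ((\poly_(i < K) a i) * (\poly_(i < K) b i))`_t.
Proof.
move=> tK; rewrite coefM; apply: eq_bigr => s _.
by rewrite !coef_poly (leq_ltn_trans (leq_subr _ _) tK)
  (leq_ltn_trans _ tK) // -ltnS.
Qed.

Lemma convA (a b c : nat -> R) t : conv (conv a b) c t = conv a (conv b c) t.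
Proof.
pose P (u : nat -> R) := \poly_(i < t.+1) u i.
transitivity ((P a * P b * P c)`_t); [|rewrite -mulrA];
  rewrite coefM; apply: eq_bigr => s _; congr (_ * _).
- by rewrite (@convE _ _ t.+1).
- by rewrite coef_poly ltnS leq_subr.
- by rewrite coef_poly ltn_ord.
- by rewrite (@convE _ _ t.+1) // ltnS leq_subr.
Qed.

Definition lmul_fun (f g : int -> R) : int -> R :=
  fun n => \sum_(i \in setT) f i * g (n - i).

Definition shf (M : nat) (f : int -> R) (t : nat) : R := f (t%:Z - M%:Z).

Definition vanish (M : nat) (f : int -> R) :=
  forall i : int, i < - M%:Z -> f i = 0.

Lemma lmul_funE (M N : nat) (f g : int -> R) :
  vanish M f -> vanish N g ->
  shf (M + N) (lmul_fun f g) =1 conv (shf M f) (shf N g).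
Proof.
move=> fM gN t; rewrite /shf /lmul_fun.
rewrite (@fsbigT_seq _ _ [seq s%:Z - M%:Z | s <- iota 0 t.+1]).
- rewrite big_map -[iota 0 t.+1]/(index_iota 0 t.+1) big_mkord.
  by apply: eq_bigr => -[s /= s_lt] _; congr (_ * g _); lia.
- by rewrite map_inj_uniq ?iota_uniq // => a b; lia.
- move=> i /mapP iN; have [iM|Mi] := ltP i (- M%:Z); first by rewrite fM ?mul0r.
  rewrite gN ?mulr0 //.
  have [|ti] := leqP (absz (i + M%:Z)) t; last by lia.
  by move=> le_t; case: iN; exists (absz (i + M%:Z)); rewrite ?mem_iota; lia.
Qed.

Lemma lmul_vanish (M N : nat) (f g : int -> R) :
  vanish M f -> vanish N g -> vanish (M + N) (lmul_fun f g).
Proof.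
move=> fM gN i iMN; rewrite /lmul_fun fsbig1 // => j _.
have [jM|Mj] := ltP j (- M%:Z); first by rewrite fM ?mul0r.
by rewrite gN ?mulr0 //; lia.
Qed.

Lemma vanish_eq M (f g : int -> R) :
  vanish M f -> vanish M g -> shf M f =1 shf M g -> f =1 g.
Proof.
move=> fM gM fg i; have [iM|Mi] := ltP i (- M%:Z); first by rewrite fM ?gM.
have := fg `|(i + M%:Z)%R|%N; rewrite /shf.
by have -> : `|(i + M%:Z)%R|%N%:Z - M%:Z = i by lia.
Qed.

Lemma lmul_subproof f g : lmul_fun f g \in @bounded_below R.
Proof.
have [[M fM] [N gN]] := (laurent_bound f, laurent_bound g).
by apply/asboolP; exists (- (M + N)%:Z); apply: lmul_vanish.
Qed.

Definition lmul f g : laurent R := Laurent (lmul_subproof f g).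

Lemma lone_subproof : (fun i : int => (i == 0)%:R) \in @bounded_below R.
Proof. by apply/asboolP; exists 0 => i i0; rewrite lt_eqF. Qed.

Definition lone : laurent R := Laurent lone_subproof.

Lemma eq_conv (a a' b b' : nat -> R) t :
  a =1 a' -> b =1 b' -> conv a b t = conv a' b' t.
Proof. by move=> aa bb; apply: eq_bigr => s _; rewrite aa bb. Qed.

Lemma lmulA : associative lmul.
Proof.
move=> f g h; apply: laurentP.
have [[[M fM] [N gN]] [L hL]] :=
  (laurent_bound f, laurent_bound g, laurent_bound h).
have gh := lmul_vanish gN hL; have fg := lmul_vanish fM gN.
apply: (@vanish_eq (M + (N + L))) => [||t].
- exact: lmul_vanish.
- by rewrite addnA; apply: lmul_vanish.
- rewrite lmul_funE // [in RHS]addnA lmul_funE //.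
  rewrite (eq_conv _ (fun=> erefl) (lmul_funE gN hL)).
  by rewrite (eq_conv _ (lmul_funE fM gN) (fun=> erefl)) convA.
Qed.

Lemma lmulC : commutative lmul.
Proof.
move=> f g; apply: laurentP => n /=; rewrite /lmul_fun.
rewrite (reindex_fsbigT (fun i => n - i)).
  by apply: eq_fsbigr => i _; rewrite mulrC subKr.
by exists (fun i => n - i) => i; rewrite subKr.
Qed.

Lemma lmul1l : left_id lone lmul.
Proof.
move=> f; apply: laurentP => n /=; rewrite /lmul_fun.
rewrite (@fsbigT_seq _ _ [:: 0]) //; last first.
  by move=> i; rewrite inE => /negPf->; rewrite mul0r.
by rewrite big_seq1 mul1r subr0.
Qed.

Lemma lmulDl : left_distributive lmul +%R.
Proof.
move=> f g h; apply: laurentP.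
have [[[M fM] [N gN]] [L hL]] :=
  (laurent_bound f, laurent_bound g, laurent_bound h).
have fM' : vanish (M + N) f by move=> i ?; apply: fM; lia.
have gN' : vanish (M + N) g by move=> i ?; apply: gN; lia.
have fgMN : vanish (M + N) (f + g : laurent R).
  by move=> i ?; rewrite /= !fctE fM' // gN' // addr0.
apply: (@vanish_eq (M + N + L)) => [||t].
- exact: lmul_vanish.
- move=> i iM; have := lmul_vanish fM' hL iM; have := lmul_vanish gN' hL iM.
  by rewrite /= !fctE => -> ->; rewrite addr0.
- rewrite lmul_funE // [RHS]/shf /= !fctE -!/(shf _ _ _) !lmul_funE //.
  by rewrite -big_split; apply: eq_bigr => s _; rewrite /shf /= mulrDl.
Qed.

Lemma lone_neq0 : lone != 0.
Proof.
by apply/eqP => /(congr1 (fun f : laurent R => f 0)) /eqP; rewrite /= oner_eq0.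
Qed.

HB.instance Definition _ := GRing.Zmodule_isComNzRing.Build (laurent R)
  lmulA lmulC lmul1l lmulDl lone_neq0.

Lemma lderiv_subproof f :
  (fun i : int => f (i + 1) *~ (i + 1)) \in @bounded_below R.
Proof.
have [M fM] := laurent_bound f; apply/asboolP; exists (- M%:Z - 1) => i iM.
by rewrite fM ?mul0rz //; lia.
Qed.

Definition lderiv f : laurent R := Laurent (lderiv_subproof f).

End LaurentRing.

Lemma lmap_subproof (R S : zmodType) (phi : {additive R -> S}) (f : laurent R) :
  phi \o f \in @bounded_below S.
Proof.
have [M fM] := laurent_bound f; apply/asboolP; exists (- M%:Z) => i iM.
by rewrite /= fM ?raddf0.
Qed.

Definition lmap (R S : zmodType) (phi : {additive R -> S}) (f : laurent R) :=
  Laurent (lmap_subproof phi f).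

Section SuperMonomials.
Context (I : countType) (odd : pred I).
Implicit Types a b c : {cmonom I}.

Definition sqfree a : bool := all (fun i => odd i ==> (a i <= 1)%N) (finsupp a).

Lemma sqfreeP a : reflect (forall i, odd i -> (a i <= 1)%N) (sqfree a).
Proof.
apply: (iffP allP) => [h i oi|h i _]; last by apply/implyP => /h.
have [ia|] := boolP (i \in finsupp a); first by apply: (implyP (h i ia)).
by rewrite -cmE_eq0 => /eqP->.
Qed.

(* The monomial a stands for the product of its variables, with multiplicity,
   in increasing order of [pickle]; [inversions a b] counts the transpositions
   of odd variables that reorder the product of a and b. *)
Definition inversions a b : nat :=
  (\sum_(i <- finsupp a | odd i)
    \sum_(j <- finsupp b | odd j && (choice.pickle j < choice.pickle i)) a i * b j)%N.

Lemma inversionsE (d e : {fset I}) a b :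
  (finsupp a `<=` d)%fset -> (finsupp b `<=` e)%fset ->
  inversions a b = (\sum_(i <- d | odd i)
    \sum_(j <- e | odd j && (choice.pickle j < choice.pickle i)) a i * b j)%N.
Proof.
move=> ad be; rewrite /inversions.
have E i : (\sum_(j <- finsupp b | odd j && (choice.pickle j < choice.pickle i)) a i * b j =
  \sum_(j <- e | odd j && (choice.pickle j < choice.pickle i)) a i * b j)%N.
  rewrite big_mkcond [RHS]big_mkcond; apply: big_fset_incl => // j _.
  by rewrite -cmE_eq0 => /eqP ->; rewrite muln0 if_same.
under eq_bigr do rewrite E.
rewrite big_mkcond [RHS]big_mkcond; apply: big_fset_incl => // i _.
rewrite -cmE_eq0 => /eqP ->; case: ifP => // _.
by rewrite big1 // => j _; rewrite mul0n.
Qed.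

Lemma inversionsMl a b c :
  inversions (mmul a b) c = (inversions a c + inversions b c)%N.
Proof.
pose d := (finsupp a `|` finsupp b)%fset.
rewrite !(@inversionsE d (finsupp c)) ?fsubsetUl ?fsubsetUr ?mdomD //.
rewrite -big_split; apply: eq_bigr => i _; rewrite -big_split.
by apply: eq_bigr => j _; rewrite cmM mulnDl.
Qed.

Lemma inversionsMr a b c :
  inversions a (mmul b c) = (inversions a b + inversions a c)%N.
Proof.
pose d := (finsupp b `|` finsupp c)%fset.
rewrite !(@inversionsE (finsupp a) d) ?fsubsetUl ?fsubsetUr ?mdomD //.
rewrite -big_split; apply: eq_bigr => i _; rewrite -big_split.
by apply: eq_bigr => j _; rewrite cmM mulnDr.
Qed.

Lemma inversions1l a : inversions mone a = 0%N.
Proof. by rewrite /inversions mdom1 big_mkcond big_seq_fset0. Qed.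

Lemma inversions1r a : inversions a mone = 0%N.
Proof. by rewrite /inversions mdom1 big1 // => i _; rewrite big_mkcond big_seq_fset0. Qed.

Lemma sqfree1 : sqfree mone.
Proof. by apply/sqfreeP => i _; rewrite cm1. Qed.

Lemma sqfreeU i : sqfree (ucm i).
Proof. by apply/sqfreeP => j _; rewrite cmU leq_b1. Qed.

Lemma sqfree_div a i : sqfree a -> sqfree (divcm a (ucm i)).
Proof.
move=> /sqfreeP sa; apply/sqfreeP => j /sa aj.
by rewrite divcmE (leq_trans (leq_subr _ _)).
Qed.

Lemma sqfreeM a b : sqfree (mmul a b) -> sqfree a && sqfree b.
Proof.
move=> /sqfreeP ab; apply/andP; split; apply/sqfreeP => i /ab;
  rewrite cmM; lia.
Qed.

Definition smonom := {a : {cmonom I} | sqfree a}.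

End SuperMonomials.

Section SuperPoly.
Context (R : comNzRingType) (I : countType) (odd : pred I).
Local Notation mon := (smonom odd).

Local Notation malgS := {malg R[mon]}.
Implicit Types (f g h : malgS) (a b c : mon).

Definition smon1 : mon := exist (fun m => sqfree odd m) _ (sqfree1 odd).
Definition smonU i : mon := exist (fun m => sqfree odd m) _ (sqfreeU odd i).
Definition smon_div a i : mon := exist (fun m => sqfree odd m) _ (sqfree_div i (valP a)).

Fact spoly_key : unit. Proof. by []. Qed.

Definition smon_of : R -> {cmonom I} -> malgS :=
  locked_with spoly_key (fun r m =>
    if insub m is Some a then << r *g a >> else 0).

Lemma smon_ofE r m :
  smon_of r m = if insub m is Some a then << r *g a >> else 0.
Proof. by rewrite /smon_of unlock. Qed.

Definition mulmon a b : malgS :=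
  smon_of ((-1) ^+ inversions odd (val a) (val b)) (mmul (val a) (val b)).

Definition spmul : malgS -> malgS -> malgS :=
  locked_with spoly_key (fun f g =>
    \sum_(a <- msupp f) \sum_(b <- msupp g) (f@_a * g@_b) *: mulmon a b).

Lemma spmulE f g : spmul f g =
  \sum_(a <- msupp f) \sum_(b <- msupp g) (f@_a * g@_b) *: mulmon a b.
Proof. by rewrite /spmul unlock. Qed.

Definition spvar i : malgS := << smonU i >>.

(* Left and right partial derivatives: for odd i, the variable i is first moved
   to the far left, resp. right, of the monomial. *)
Definition lpartial i f : malgS :=
  \sum_(a <- msupp f) << f@_a * (-1) ^+ inversions odd (ucm i) (val (smon_div a i))
                           *+ val a i *g smon_div a i >>.

Definition rpartial i f : malgS :=
  \sum_(a <- msupp f) << f@_a * (-1) ^+ inversions odd (val (smon_div a i)) (ucm i)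
                           *+ val a i *g smon_div a i >>.

(* The derivation sending each variable i to phi i; a finite sum. The formula
   holds for phi homogeneous of either parity. *)
Definition sderivation (phi : I -> malgS) f : malgS :=
  \sum_(i \in setT) spmul (phi i) (lpartial i f).

Definition sfilter (P : pred mon) f : malgS :=
  \sum_(a <- msupp f | P a) << f@_a *g a >>.

Lemma spmulw (d e : {fset mon}) f g :
  (msupp f `<=` d)%fset -> (msupp g `<=` e)%fset ->
  spmul f g = \sum_(a <- d) \sum_(b <- e) (f@_a * g@_b) *: mulmon a b.
Proof.
move=> fd ge; rewrite spmulE (big_fset_incl _ fd) /=.
  apply: eq_bigr => a _; apply: big_fset_incl => // b _ /mcoeff_outdom ->.
  by rewrite mulr0 scale0r.
move=> a _ /mcoeff_outdom fa.
by rewrite big1 // => b _; rewrite fa mul0r scale0r.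
Qed.

Lemma spmulDl : left_distributive spmul +%R.
Proof.
move=> f g h; pose d := (msupp f `|` msupp g)%fset.
rewrite !(@spmulw d (msupp h)) ?fsubsetUl ?fsubsetUr ?msuppD_le //.
rewrite -big_split; apply: eq_bigr => a _; rewrite -big_split.
by apply: eq_bigr => b _; rewrite mcoeffD mulrDl scalerDl.
Qed.

Lemma spmulDr : right_distributive spmul +%R.
Proof.
move=> h f g; pose d := (msupp f `|` msupp g)%fset.
rewrite !(@spmulw (msupp h) d) ?fsubsetUl ?fsubsetUr ?msuppD_le //.
rewrite -big_split; apply: eq_bigr => a _; rewrite -big_split.
by apply: eq_bigr => b _; rewrite mcoeffD mulrDr scalerDl.
Qed.

Lemma spmul0l : left_zero 0 spmul.
Proof. by move=> f; rewrite spmulE msupp0 big_seq_fset0. Qed.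

Lemma spmul0r : right_zero 0 spmul.
Proof.
by move=> f; rewrite spmulE big1 // => a _; rewrite msupp0 big_seq_fset0.
Qed.

Lemma spmulUU (u v : R) a b :
  spmul << u *g a >> << v *g b >> = (u * v) *: mulmon a b.
Proof.
by rewrite (spmulw msuppU_le msuppU_le) !big_seq_fset1 !mcoeffUU.
Qed.

Lemma scaleU (u v : R) a : u *: (<< v *g a >> : malgS) = << u * v *g a >>.
Proof. by apply/malgP => b; rewrite (mcoeffU a (u * v)) mcoeffZ mcoeffU mulrnAr. Qed.

Lemma scale_smon (u r : R) (m : {cmonom I}) : u *: smon_of r m = smon_of (u * r) m.
Proof.
by rewrite !smon_ofE; case: insubP => [a _ _|_]; [exact: scaleU | exact: scaler0].
Qed.

Lemma spmulUmon (u r : R) a (m : {cmonom I}) :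
  spmul << u *g a >> (smon_of r m)
  = smon_of (u * r * (-1) ^+ inversions odd (val a) m) (mmul (val a) m).
Proof.
rewrite smon_ofE; case: insubP => [b _ <-|nm].
  by rewrite spmulUU scale_smon.
rewrite spmul0r smon_ofE insubF //.
by apply: contraNF nm => /sqfreeM/andP[].
Qed.

Lemma spmulmonU (u r : R) a (m : {cmonom I}) :
  spmul (smon_of r m) << u *g a >>
  = smon_of (r * u * (-1) ^+ inversions odd m (val a)) (mmul m (val a)).
Proof.
rewrite smon_ofE; case: insubP => [b _ <-|nm].
  by rewrite spmulUU scale_smon.
rewrite spmul0l smon_ofE insubF //.
by apply: contraNF nm => /sqfreeM/andP[].
Qed.

Lemma sign_shuffle (u v w x y z : R) :
  u * (v * w * x) * (y * z) = u * v * y * w * (z * x).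
Proof. by ring. Qed.

Lemma mulmonA (u v w : R) a b c :
  spmul << u *g a >> (spmul << v *g b >> << w *g c >>) =
  spmul (spmul << u *g a >> << v *g b >>) << w *g c >>.
Proof.
rewrite [X in spmul _ X = _]spmulUU [X in _ = spmul X _]spmulUU.
rewrite [X in spmul _ X = _]scale_smon [X in _ = spmul X _]scale_smon.
rewrite [LHS]spmulUmon [RHS]spmulmonU.
rewrite mulmA inversionsMl inversionsMr.
rewrite (exprD _ (inversions _ _ _)).
rewrite (exprD _ (inversions _ (val a) (val c))).
apply: (congr1 (smon_of^~ _)).
exact: sign_shuffle.
Qed.

Lemma malg_ind (P : malgS -> Prop) :
  P 0 -> (forall f g, P f -> P g -> P (f + g)) ->
  (forall u a, P << u *g a >>) -> forall f, P f.
Proof. by move=> P0 PD PU f; rewrite (monalgE f); apply: big_ind. Qed.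

Lemma spmulA : associative spmul.
Proof.
move=> f g h; elim/malg_ind: f => [|f1 f2 IH1 IH2|u a].
- by rewrite [LHS]spmul0l [X in _ = spmul X _]spmul0l [RHS]spmul0l.
- by rewrite [LHS]spmulDl IH1 IH2 [X in _ = spmul X _]spmulDl [RHS]spmulDl.
elim/malg_ind: g => [|g1 g2 IH1 IH2|v b].
- rewrite [X in spmul _ X = _]spmul0l [LHS]spmul0r [X in _ = spmul X _]spmul0r.
  by rewrite [RHS]spmul0l.
- move: << u *g a >> IH1 IH2 => e IH1 IH2.
  rewrite [X in spmul _ X = _]spmulDl [LHS]spmulDr IH1 IH2.
  by rewrite [X in _ = spmul X _]spmulDr [RHS]spmulDl.
elim/malg_ind: h => [|h1 h2 IH1 IH2|w c]; last exact: mulmonA.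
- by rewrite [X in spmul _ X = _]spmul0r [LHS]spmul0r [RHS]spmul0r.
- move: << u *g a >> << v *g b >> IH1 IH2 => e e' IH1 IH2.
  rewrite [X in spmul _ X = _]spmulDr [LHS]spmulDr IH1 IH2.
  by rewrite [RHS]spmulDr.
Qed.

Definition spone : malgS := << smon1 >>.

Lemma spmul1l : left_id spone spmul.
Proof.
move=> f; elim/malg_ind: f => [|f g IHf IHg|u a]; first exact: spmul0r.
  by rewrite [LHS]spmulDr IHf IHg.
rewrite [LHS]spmulUU /mulmon mul1m inversions1l mul1r [LHS]scale_smon mulr1.
by rewrite smon_ofE valK.
Qed.

Lemma spmul1r : right_id spone spmul.
Proof.
move=> f; elim/malg_ind: f => [|f g IHf IHg|u a]; first exact: spmul0l.
  by rewrite [LHS]spmulDl IHf IHg.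
rewrite [LHS]spmulUU /mulmon mulm1 inversions1r mulr1 [LHS]scale_smon mulr1.
by rewrite smon_ofE valK.
Qed.

Lemma spone_neq0 : spone != 0.
Proof. by rewrite monalgU_eq0 oner_eq0. Qed.

Definition spoly := {malg R[mon]}.

HB.instance Definition _ := GRing.Lmodule.on spoly.
HB.instance Definition _ := GRing.Zmodule_isNzRing.Build spoly
  spmulA spmul1l spmul1r spmulDl spmulDr spone_neq0.

End SuperPoly.


Section PartialDerivatives.
Context (R : comNzRingType) (I : choiceType).

Definition mpartial (i : I) (p : {malg R[cmonom I]}) : {malg R[cmonom I]} :=
  \sum_(a <- msupp p) << p@_a *+ a i *g divcm a (ucm i) >>.

End PartialDerivatives.

Section Variational.
Context (k : fieldType).

Definition diffalg := {malg (laurent k)[cmonom nat]}.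
Implicit Types E D : diffalg.

HB.instance Definition _ := GRing.ComNzRing.on diffalg.

Definition jvar (i : nat) : diffalg := << ucm i >>.

Definition dz E : diffalg :=
  \sum_(a <- msupp E) << lderiv E@_a *g a >>
  + \sum_(i \in setT) jvar i.+1 * mpartial i E.

Definition variational_derivative D : diffalg :=
  \sum_(i \in setT) (-1) ^+ i * iter i dz (mpartial i D).

Definition ypoly := {malg k[cmonom int]}.
HB.instance Definition _ := GRing.ComNzRing.on ypoly.

(* O(LA^1) is the limit over n of the k[y_i | i >= -n]; an element of the n-th
   algebra is seen as a polynomial in all the y_i, and the transition maps set
   the additional variables to 0. *)
Lemma generic_loop_subproof (n : nat) :
  (fun i : int => if - n%:Z <= i then << ucm i >> else 0 : ypoly)
    \in @bounded_below ypoly.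
Proof. by apply/asboolP; exists (- n%:Z) => i; rewrite ltNge => /negPf->. Qed.

Definition generic_loop (n : nat) : laurent ypoly :=
  Laurent (generic_loop_subproof n).

(* E(z, y(z), y'(z), ...) over k[y_i | i >= -n]. *)
Definition eval_loop E (n : nat) : laurent ypoly :=
  mmap (lmap (@malgC (cmonom int) k))
    (fun a : cmonom nat =>
       \prod_(i <- finsupp a) iter i (@lderiv _) (generic_loop n) ^+ a i) E.

Definition Ecoef E (j : int) (n : nat) : ypoly := eval_loop E n j.

(* The condition on m under which the pro-algebra below models dSol(E). *)
Record admissible E (m : nat -> int) : Prop := Admissible {
  admissible_mono : forall n n' : nat, (n <= n')%N -> m n <= m n';
  admissible_cofinal : forall B : int, exists n : nat, B <= m n;
  admissible_vanish : forall (n : nat) (j : int), j < - m n -> Ecoef E j n = 0 }.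

Lemma admissible_exists E : exists m, admissible E m.
Proof.
have /choice[b bP] n := laurent_bound (eval_loop E n).
exists (fun n => (\sum_(l < n.+1) b l + n)%N%:Z); split.
- move=> n n' nn'; rewrite lez_nat leq_add //.
  rewrite -(big_mkord xpredT b) -(big_mkord xpredT b).
  by rewrite (@big_cat_nat _ _ _ n.+1 0 n'.+1) //= leq_addr.
- by move=> B; exists `|B|%N; lia.
- move=> n j jn; apply: bP.
  by apply: lt_le_trans jn _; rewrite big_ord_recr /=; lia.
Qed.
End Variational.

Inductive dvar := Yv of int | Xiv of int.

Definition dvar_enc v : int + int :=
  match v with Yv i => inl i | Xiv j => inr j end.
Definition dvar_dec s : dvar :=
  match s with inl i => Yv i | inr j => Xiv j end.
Lemma dvar_encK : cancel dvar_enc dvar_dec. Proof. by case. Qed.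
HB.instance Definition _ := Countable.copy dvar (can_type dvar_encK).

Definition is_xi v := if v is Xiv _ then true else false.
Definition idx v : int := match v with Yv i => i | Xiv j => j end.

(* (false, v) is the generator v and (true, v) is its differential dv. *)
Definition dRgen := (bool * dvar)%type.
HB.instance Definition _ := Countable.on dRgen.
Definition dR_odd (g : dRgen) : bool := g.1 (+) is_xi g.2.

Section DerivedSolutions.
Context (k : fieldType).

(* Signs follow the total degree: internal degree plus form weight. *)
Definition dR := spoly k dR_odd.
HB.instance Definition _ := GRing.NzRing.on dR.
HB.instance Definition _ := GRing.Lmodule.on dR.
Implicit Types f : dR.

Definition gen v : dR := spvar k dR_odd (false, v).
Definition dgen v : dR := spvar k dR_odd (true, v).

Definition weight (a : smonom dR_odd) : nat :=
  (\sum_(g <- finsupp (val a) | g.1) val a g)%N.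
Definition degree (a : smonom dR_odd) : int :=
  - (\sum_(g <- finsupp (val a) | is_xi g.2) val a g)%N%:Z.

Definition d_dR : dR -> dR :=
  sderivation (fun g => if g.1 then 0 else dgen g.2).

Definition poly_dR (p : ypoly k) : dR :=
  mmap (fun c => c *: (1 : dR))
    (fun a : cmonom int => \prod_(i <- finsupp a) gen (Yv i) ^+ a i) p.

(* The sign involution: (-1)^(internal degree) on forms of weight 0. *)
Definition sgn_inv f : dR :=
  \sum_(a <- msupp f) << (-1) ^+ `|degree a|%N * f@_a *g a >>.

Context (E : diffalg k) (m : nat -> int).

(* The generators of the n-th algebra A_n of the pro-system:
   y_i for i >= -n and xi_j for j >= -m(n). *)
Definition in_level (n : nat) v : bool :=
  match v with Yv i => - n%:Z <= i | Xiv j => - m n <= j end.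

Definition mon_level (n : nat) (a : smonom dR_odd) : bool :=
  all (fun g : dRgen => in_level n g.2) (finsupp (val a)).

(* The de Rham algebra of A_n is the subalgebra of dR generated by the v and dv
   with v in level n; the transition maps kill the other generators. *)
Definition truncate (n : nat) : dR -> dR := sfilter (mon_level n).

Definition is_form (n w : nat) (e : int) : set dR := [set f |
  forall a, a \in msupp f -> [/\ mon_level n a, weight a = w & degree a = e]].

Definition A_ (n : nat) : set dR :=
  [set f | forall a, a \in msupp f -> mon_level n a /\ weight a = 0%N].

(* The internal differential: y_i, dy_i |-> 0, xi_j |-> E_j,
   dxi_j |-> - d_dR E_j. *)
Definition d_int (n : nat) : dR -> dR :=
  sderivation (fun g => match g with
    | (false, Xiv j) => poly_dR (Ecoef E j n)
    | (true, Xiv j) => - d_dR (poly_dR (Ecoef E j n))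
    | _ => 0 end).

(* Elements of bidegree (w, e) of the limit over n of the de Rham algebras. *)
Record proform (w : nat) (e : int) (f : nat -> dR) : Prop := Proform {
  proform_form : forall n, is_form n w e (f n);
  proform_compat : forall n, truncate n (f n.+1) = f n }.

(* A closed 2-form of degree -1 is a series w_0 + w_1 + ..., with w_q of weight
   q + 2 and the same total degree as w_0, killed by d_int + d_dR; its
   underlying 2-form is w_0. *)
Record closed_2form (w : nat -> nat -> dR) : Prop := Closed2Form {
  closed_proform : forall q, proform q.+2 (- q.+1%:Z) (w q);
  closed_d_int : forall n, d_int n (w 0%N n) = 0;
  closed_d_dR : forall q n, d_dR (w q n) + d_int n (w q.+1 n) = 0 }.

Definition strictly_closed (f : nat -> dR) : nat -> nat -> dR :=
  fun q => if q is 0%N then f else fun=> 0.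

(* A complete topological dg A_n-module with a topological basis indexed by the
   generators v, given by its coordinates; [td_nbhd] is a basis of open
   submodules and [td_deg e] the set of homogeneous elements of degree e. It
   stands for the pro-object of its quotients by open dg submodules. *)
Record tdgmod := TDGMod {
  td_car : set (dvar -> dR);
  td_nbhd : nat -> set (dvar -> dR);
  td_deg : int -> set (dvar -> dR);
  td_diff : (dvar -> dR) -> dvar -> dR }.

Definition td_scale (a : dR) (x : dvar -> dR) : dvar -> dR := fun v => a * x v.

(* Continuous A_n-linear maps of degree s, with the Koszul sign. *)
Record cont_linear (n : nat) (s : int) (M M' : tdgmod)
    (F : (dvar -> dR) -> dvar -> dR) : Prop := ContLinear {
  cl_car : forall x, td_car M x -> td_car M' (F x);
  cl_add : forall x y, td_car M x -> td_car M y -> F (x + y) = F x + F y;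
  cl_act : forall a x, A_ n a -> td_car M x ->
    F (td_scale a x) = td_scale (iter `|s|%N sgn_inv a) (F x);
  cl_deg : forall e x, td_car M x -> td_deg M e x -> td_deg M' (e + s) (F x);
  cl_cont : forall N', exists N, forall x, td_car M x -> td_nbhd M N x ->
    td_nbhd M' N' (F x) }.

Definition chain_map (n : nat) (M M' : tdgmod)
    (F : (dvar -> dR) -> dvar -> dR) : Prop :=
  cont_linear n 0 M M' F /\
  (forall x, td_car M x -> F (td_diff M x) = td_diff M' (F x)).

Definition homotopic_id (n : nat) (M : tdgmod)
    (F : (dvar -> dR) -> dvar -> dR) : Prop :=
  exists h, cont_linear n (-1) M M h /\
    (forall x, td_car M x -> F x - x = td_diff M (h x) + h (td_diff M x)).

(* When, as for T and L below, the open dg submodules are a basis of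
   neighbourhoods and the quotients are semi-free, the equivalences of
   pro-objects of the derived category of A_n are exactly the continuous
   homotopy equivalences: derived maps into a limit along split surjections
   are continuous maps up to homotopy. *)
Definition tdg_equivalence (n : nat) (M M' : tdgmod)
    (F : (dvar -> dR) -> dvar -> dR) : Prop :=
  chain_map n M M' F /\
  exists G, [/\ chain_map n M' M G, homotopic_id n M (G \o F)
             & homotopic_id n M' (F \o G)].

(* The quotients of L by the open dg submodules are perfect, so that L is in
   Pro(Perf); M/L is discrete, hence in Ind(Perf). *)
Record lattice (n : nat) (M : tdgmod) (L : set (dvar -> dR)) : Prop := Lattice {
  lattice_sub : L `<=` td_car M;
  lattice_open : exists N, td_car M `&` td_nbhd M N `<=` L;
  lattice_add : forall x y, L x -> L y -> L (x + y);
  lattice_scale : forall a x, A_ n a -> L x -> L (td_scale a x);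
  lattice_diff : forall x, L x -> L (td_diff M x);
  lattice_perfect : forall N, exists s : seq (dvar -> dR),
    (forall i : 'I_(size s), L s`_i /\ exists e, td_deg M e s`_i) /\
    forall x, L x -> exists! c : 'I_(size s) -> dR,
      (forall i, A_ n (c i)) /\
      td_nbhd M N (x - \sum_(i < size s) td_scale (c i) s`_i) }.

Definition tate (n : nat) (M : tdgmod) : Prop :=
  (forall N x, td_car M x -> td_nbhd M N x -> td_nbhd M N (td_diff M x)) /\
  exists L, lattice n M L.

(* The restriction to A_n of the partial derivative of E_j by y_i. *)
Definition jacobian (n : nat) (j i : int) : dR :=
  truncate n (poly_dR (mpartial i (Ecoef E j (n + `|i|)%N))).

(* L[-1] is the part of weight 1 of the de Rham algebra, the limit over N >= n
   of the free A_n-modules on the dv with v in level N; x is sum_v x_v dv. *)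
Definition cotangent_shift (n : nat) : tdgmod := TDGMod
  [set x | (forall v, A_ n (x v)) /\
           forall N, finite_set [set v | in_level N v /\ x v <> 0]]
  (fun N => [set x | forall v, in_level (n + N)%N v -> x v = 0])
  (fun e => [set x | forall v,
     is_form n 0 (if is_xi v then e else e - 1) (x v)])
  (fun x v => match v with
     | Yv i => d_int n (x v)
               - \sum_(j \in setT) sgn_inv (x (Xiv j)) * jacobian n j i
     | Xiv _ => d_int n (x v) end).

(* T is the Tate dual of L: the continuous A_n-linear functionals on L, i.e. the
   continuous derivations sum_v x_v d/dv with values in A_n, with differential
   the commutator with d_int; the open submodules are the orthogonals of the
   lattices { y | y_v = 0 for idx v >= N }. *)
Definition tangent (n : nat) : tdgmod := TDGMod
  [set x | (forall v, A_ n (x v)) /\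
           exists N, forall v, ~~ in_level N v -> x v = 0]
  (fun N => [set x | forall v, idx v < N%:Z -> x v = 0])
  (fun e => [set x | forall v,
     is_form n 0 (if is_xi v then e - 1 else e) (x v)])
  (fun x v => match v with
     | Yv _ => d_int n (x v)
     | Xiv j => d_int n (x v)
                - \sum_(i \in setT) sgn_inv (x (Yv i)) * jacobian n j i end).

(* The coefficient w_{v v'} in A_n of a 2-form w: the contraction of w with d/dv
   is sum_v' w_{v v'} dv'. It is read off at any level N >= n containing
   v and v'. *)
Definition form_coef (n : nat) (f : nat -> dR) (v v' : dvar) : dR :=
  let N := xget n
    [set N | [/\ (n <= N)%N, in_level N v & in_level N v']] in
  truncate n (rpartial (true, v') (lpartial (true, v) (f N))).

Definition contraction (n : nat) (f : nat -> dR) (x : dvar -> dR) : dvar -> dR :=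
  fun v' => \sum_(v \in setT) x v * form_coef n f v v'.

Definition nondegenerate (f : nat -> dR) : Prop :=
  forall n, tdg_equivalence n (tangent n) (cotangent_shift n) (contraction n f).

Record tate_symplectic (w : nat -> nat -> dR) : Prop := TateSymplectic {
  symplectic_tate : forall n, tate n (cotangent_shift n);
  symplectic_closed : closed_2form w;
  symplectic_nondegenerate : nondegenerate (w 0%N) }.

(* sum_i dy_i dxi_(-1-i), a finite sum at each level. *)
Definition residue_form (n : nat) : dR :=
  \sum_(i \in [set i : int | in_level n (Yv i) /\ in_level n (Xiv (-1 - i))])
    dgen (Yv i) * dgen (Xiv (-1 - i)).

End DerivedSolutions.

(* Main.v *)
(* A derivation d/dy_i of k[y_j] acts coefficientwise on Laurent series and
   commutes with d/dz, so the chain rule and integration by parts under the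
   residue show that S = res D(y(z)) satisfies
     dS / dy_i = res (z^i (delta D)(y(z))) = (delta D)_{-1-i}.
   Hence the Jacobian of the equations is the Hessian of S: its (-1-i, l) entry
   d^2 S / dy_i dy_l is symmetric in (i, l).
   The symmetry makes the form closed for the internal differential, which maps
   it to - sum_{i,l} dy_l (d^2 S / dy_i dy_l) dy_i = 0. It also says that the
   contraction with the form, which only permutes coordinates by exchanging y_i
   with xi_{-1-i}, is a chain map; this map is its own inverse, and it is
   continuous in both directions because m tends to infinity. The Tate lattice
   consists of the forms whose coordinates at level n vanish. *)
From HB Require Import structures.
Require Import Defs.
From mathcomp Require Import all_boot all_order all_algebra.
From mathcomp Require Import finmap monalg boolp classical_sets.
From mathcomp Require Import functions cardinality fsbigop zify ring.
Set Implicit Arguments.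
Unset Strict Implicit.
Unset Printing Implicit Defensive.
Import Order.TTheory GRing.Theory Num.Theory.
Local Open Scope ring_scope.
Local Open Scope classical_set_scope.

(** * Derivations and polynomials in commuting variables *)

(** The obstacle is the level. At level n the variable y_i is 0 for i < -n, so the variational
    identity is available only for i >= -n, whereas the differentials of the tangent and cotangent
    modules over A_n involve d/dy_i for every i. Such an entry of the Jacobian has to be computed at
    a level where y_i survives and then truncated; the choice of that level turns out to be
    immaterial, so symmetry can be checked at a level containing both variables. The form at level n
    sees only the window -n <= i < m n. Admissibility makes the derivatives dS/dy_i with i >= m n
    vanish at level n, which allows the sum over the window to be completed to an alternating double
    sum over a single list. No genuine homotopy occurs: the higher terms of the closed form and both
    homotopies of the equivalence are 0. *)

Definition leibniz (A : nzRingType) (d : A -> A) :=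
  forall x y, d (x * y) = d x * y + x * d y.

Section Leibniz.
Context (A : comNzRingType) (d : {additive A -> A}).

(** This and the next three lemmas assume the rule only for the pairs at hand: they are the
    inductive steps that reduce it to monomials in [mpartialM]. *)
Lemma leibnizDl x1 x2 y :
  d (x1 * y) = d x1 * y + x1 * d y -> d (x2 * y) = d x2 * y + x2 * d y ->
  d ((x1 + x2) * y) = d (x1 + x2) * y + (x1 + x2) * d y.
Proof. by move=> d1 d2; rewrite mulrDl !raddfD /= d1 d2 !mulrDl addrACA. Qed.

Lemma leibnizDr x y1 y2 :
  d (x * y1) = d x * y1 + x * d y1 -> d (x * y2) = d x * y2 + x * d y2 ->
  d (x * (y1 + y2)) = d x * (y1 + y2) + x * d (y1 + y2).
Proof. by move=> d1 d2; rewrite mulrDr !raddfD /= d1 d2 !mulrDr addrACA. Qed.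

Lemma leibniz0l y : d (0 * y) = d 0 * y + 0 * d y.
Proof. by rewrite !mul0r raddf0 mul0r addr0. Qed.

Lemma leibniz0r x : d (x * 0) = d x * 0 + x * d 0.
Proof. by rewrite !mulr0 raddf0 mulr0 addr0. Qed.

Hypothesis dM : leibniz d.

Lemma leibniz1 : d 1 = 0.
Proof. by have /eqP := dM 1 1; rewrite !mulr1 mul1r -subr_eq0 opprD addNKr
  oppr_eq0 => /eqP. Qed.

Lemma leibnizX x n : d (x ^+ n) = x ^+ n.-1 * d x *+ n.
Proof.
elim: n => [|n IH]; first by rewrite leibniz1 mulr0n.
rewrite exprS dM IH mulrSr addrC [d x * _]mulrC mulrnAr mulrA.
by case: n {IH} => [|n]; rewrite ?mulr0n // -exprS.
Qed.

Lemma leibniz_prod (I : eqType) (r : seq I) (F : I -> A) : uniq r ->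
  d (\prod_(i <- r) F i) =
  \sum_(i <- r) d (F i) * \prod_(j <- r | j != i) F j.
Proof.
elim: r => [|i r IH] /=; first by rewrite !big_nil leibniz1.
case/andP=> ir ur; rewrite !big_cons eqxx /= dM IH // mulr_sumr.
congr (_ * _ + _).
  rewrite big_seq [RHS]big_seq_cond; apply: eq_bigl => j.
  by case: (boolP (j \in r)) => //= jr; apply/esym/eqP => ji;
    rewrite -ji jr in ir.
apply: eq_big_seq => j jr; rewrite big_cons.
by case: eqP => [ij|_]; [rewrite ij jr in ir | rewrite mulrCA].
Qed.

(** Integration by parts, one derivative at a time: the boundary term [d (x * iter a d y)] is killed
    by [res]. The sign is that of the variational derivative. *)
Lemma leibniz_iter_residue (V : zmodType) (res : {additive A -> V}) a x y :
  (forall z, res (d z) = 0) ->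
  res (x * iter a d y) = res ((-1) ^+ a * iter a d x * y).
Proof.
move=> res0; elim: a x => [|a IH] x; first by rewrite mul1r.
have -> : x * iter a.+1 d y = d (x * iter a d y) - d x * iter a d y.
  by rewrite dM addrC addKr.
by rewrite raddfB /= res0 sub0r IH exprS mulN1r !mulNr raddfN -iterSr.
Qed.

End Leibniz.

Section MalgPartial.
Context (R : comNzRingType) (I : choiceType).
Implicit Types (p q : {malg R[cmonom I]}) (a b : cmonom I).

Lemma cmalgP p q : (forall a, p@_a = q@_a) -> p = q.
Proof. exact: (malgP p q).1. Qed.

Lemma cmalg_ind (P : {malg R[cmonom I]} -> Prop) :
  P 0 -> (forall p q, P p -> P q -> P (p + q)) ->
  (forall (c : R) a, P << c *g a >>) -> forall p, P p.
Proof. by move=> P0 PD PU p; rewrite (monalgE p); apply: big_ind. Qed.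

(** Only the monomial b x_i contributes to b. With this formula, additivity, commutation of partials
    and compatibility with restriction become checks on coefficients. *)
Lemma mcoeff_mpartial i p b :
  (mpartial i p)@_b = p@_(mulcm b (ucm i)) *+ (b i).+1.
Proof.
rewrite /mpartial raddf_sum /= (eq_bigr
  (fun a => if a == mulcm b (ucm i) then p@_a *+ (b i).+1 else 0)).
  have [bp|bp] := boolP (mulcm b (ucm i) \in msupp p).
    rewrite (big_fsetD1 _ bp) /= eqxx big1_fset ?addr0 // => a.
    by rewrite in_fsetD1 => /andP[/negPf->].
  rewrite big1_fset ?(mcoeff_outdom bp) ?mul0rn // => a ap _.
  by case: eqP ap bp => // -> ->.
move=> a _; rewrite mcoeffU; have [->|ab] := eqVneq a (mulcm b (ucm i)).
  have -> : divcm (mulcm b (ucm i)) (ucm i) = b.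
    by apply/eqP/cmP => j; rewrite divcmE mulcmE addnK.
  by rewrite eqxx mulcmE cmUU addn1.
(* [divcm] truncates, so a monomial without the variable [i] is divided to itself, but then its
   multiplicity [a i] is 0. *)
case: eqP => [ab'|//]; case: (posnP (a i)) => [->//|ai].
case/eqP: ab; apply/eqP/cmP => j; rewrite mulcmE -ab' divcmE cmU.
by case: eqP => [<-|]; lia.
Qed.

Lemma mpartialU i (c : R) a :
  mpartial i << c *g a >> = << c *+ a i *g divcm a (ucm i) >>.
Proof.
rewrite /mpartial msuppU; case: eqP => [->|_].
  by rewrite big_seq_fset0 mul0rn monalgU0.
by rewrite big_seq_fset1 mcoeffUU.
Qed.

Local Opaque mpartial.

Lemma mpartial_is_additive i : additive (@mpartial R I i).
Proof.
move=> p q; apply: cmalgP => a.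
rewrite [LHS]mcoeff_mpartial [RHS]mcoeffB (mcoeffB (mulcm a (ucm i)) p q).
by rewrite mulrnBl -!mcoeff_mpartial.
Qed.

HB.instance Definition _ i := GRing.isAdditive.Build
  {malg R[cmonom I]} {malg R[cmonom I]} (@mpartial R I i) (mpartial_is_additive
    i).

Lemma mpartialC i j p : mpartial i (mpartial j p) = mpartial j (mpartial i p).
Proof.
apply: cmalgP => b; rewrite [LHS]mcoeff_mpartial [RHS]mcoeff_mpartial.
rewrite (mcoeff_mpartial j p) (mcoeff_mpartial i p) -!mulrnA.
rewrite -!mulcmA (mulcmC (ucm i)); congr (_ *+ _).
by rewrite !mulcmE !cmU eq_sym; case: eqP => [->|]; lia.
Qed.

Lemma malgUM (c d : R) (a b : cmonom I) :
  (<< c *g a >> : {malg R[cmonom I]}) * << d *g b >> = << c * d *g mmul a b >>.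
Proof. exact: fgmulUU. Qed.

Lemma divcmMl a b i : (0 < a i)%N ->
  divcm (mmul a b) (ucm i) = mmul (divcm a (ucm i)) b.
Proof.
move=> ai; apply/eqP/cmP => j; rewrite !(divcmE, cmM) cmU.
by case: eqP => [<-|]; lia.
Qed.

Lemma mpartialM i p q :
  mpartial i (p * q) = mpartial i p * q + p * mpartial i q.
Proof.
elim/cmalg_ind: p => [|p1 p2 IH1 IH2|c a]; first exact: leibniz0l.
  exact: leibnizDl IH1 IH2.
elim/cmalg_ind: q => [|q1 q2 IH1 IH2|d b]; first exact: leibniz0r.
  exact: leibnizDr IH1 IH2.
rewrite [X in mpartial _ X = _]malgUM [LHS]mpartialU.
rewrite [X in _ = X * _ + _]mpartialU [X in _ = _ + _ * X]mpartialU.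
rewrite [X in _ = X + _]malgUM [X in _ = _ + X]malgUM.
rewrite cmM mulrnDr [LHS]monalgUD mulrnAl mulrnAr.
apply: (congr2 +%R).
  by case: (posnP (a i)) => [->|ai]; rewrite ?mulr0n ?monalgU0 ?divcmMl.
case: (posnP (b i)) => [->|bi]; first by rewrite !mulr0n !monalgU0.
by rewrite (mulmC a b) (divcmMl a bi) (mulmC _ a).
Qed.

End MalgPartial.

(** * Evaluation of polynomials and the chain rule *)

Section ChainRule.
Context (R : comNzRingType) (I : choiceType) (S : comNzRingType).
Context (phi : {additive R -> S}) (g : I -> S).
Implicit Types (p q : {malg R[cmonom I]}) (a b : cmonom I).

Definition mon_eval a : S := \prod_(i <- finsupp a) g i ^+ a i.

(** Lets one duplicate-free list index several monomials at once, extra variables having exponent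
    0. *)
Lemma mon_evalE (r : seq I) a : uniq r -> {subset finsupp a <= r} ->
  mon_eval a = \prod_(i <- r) g i ^+ a i.
Proof.
move=> ur ar; rewrite /mon_eval [RHS](bigID (mem (finsupp a))) /=.
rewrite [X in _ = _ * X]big1 ?mulr1; last first.
  by move=> i; rewrite -cmE_eq0 => /eqP->.
rewrite -[RHS]big_filter; apply: perm_big; apply: uniq_perm => [||i].
- exact: fset_uniq.
- exact: filter_uniq.
- by rewrite mem_filter; apply/idP/andP => [ia|[]//]; split=> //; apply: ar.
Qed.

Lemma mon_evalM a b : mon_eval (mmul a b) = mon_eval a * mon_eval b.
Proof.
rewrite (@mon_evalE (finsupp a `|` finsupp b)%fset a) ?fset_uniq //; last first.
  by move=> i ia; rewrite inE ia.
rewrite (@mon_evalE (finsupp a `|` finsupp b)%fset b) ?fset_uniq //; last first.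
  by move=> i ia; rewrite inE ia orbT.
rewrite /mon_eval mdomD -big_split; apply: eq_bigr => i _ /=.
by rewrite cmM exprD.
Qed.

Lemma mon_evalU i : mon_eval (ucm i) = g i.
Proof. by rewrite /mon_eval mdomU big_seq_fset1 cmUU expr1. Qed.

Lemma mmap_mpartial i p : mmap phi mon_eval (mpartial i p) =
  \sum_(a <- msupp p) phi (p@_a *+ a i) * mon_eval (divcm a (ucm i)).
Proof.
by rewrite raddf_sum; apply: eq_bigr => a _; exact: mmapU.
Qed.

Lemma mmap_mulU i p :
  mmap phi mon_eval (<< ucm i >> * p) = g i * mmap phi mon_eval p.
Proof.
rewrite malgM_def fgmulUg raddf_sum mulr_sumr; apply: eq_bigr => a _.
by rewrite /= mmapU mul1r mon_evalM mon_evalU mulrCA.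
Qed.

Context (d : {additive S -> S}) (dM : leibniz d).

Lemma leibniz_mon_eval (r : seq I) a : uniq r -> {subset finsupp a <= r} ->
  d (mon_eval a) = \sum_(i <- r) mon_eval (divcm a (ucm i)) * d (g i) *+ a i.
Proof.
move=> ur ar; rewrite (mon_evalE ur ar) leibniz_prod //.
apply: eq_big_seq => i ir; rewrite leibnizX // mulrnAl;
  case: (posnP (a i)) => [->//|ai].
congr (_ *+ _); rewrite mulrAC; congr (_ * _).
rewrite (@mon_evalE r) //; last first.
  move=> j; rewrite -cmE_neq0 divcmE => ja; apply: ar.
  by rewrite -cmE_neq0; lia.
rewrite [RHS](big_rem i ir) /= rem_filter // big_filter divcmE cmUU subn1.
congr (_ * _); apply: eq_bigr => j ji.
by rewrite divcmE cmU eq_sym (negPf ji) subn0.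
Qed.

(** [d] may act on the coefficients too. The rule serves for d/dz, where the first sum
    differentiates the coefficients in k((z)), and for d/dy_i, where that sum vanishes. *)
Lemma mmap_chain_rule (r : seq I) p :
  uniq r -> (forall a, a \in msupp p -> {subset finsupp a <= r}) ->
  d (mmap phi mon_eval p) = \sum_(a <- msupp p) d (phi p@_a) * mon_eval a
    + \sum_(i <- r) mmap phi mon_eval (mpartial i p) * d (g i).
Proof.
move=> ur pr; rewrite [X in d X]mmapE raddf_sum /=.
rewrite (eq_bigr _ (fun a _ => dM _ _)) big_split /=; congr (_ + _).
under [RHS]eq_bigr do rewrite mmap_mpartial mulr_suml.
rewrite exchange_big /=; apply: eq_big_seq => a ap.
rewrite (leibniz_mon_eval ur (pr _ ap)) mulr_sumr; apply: eq_bigr => i _.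
by rewrite [in RHS]raddfMn !mulrnAl mulrnAr mulrA.
Qed.

End ChainRule.

(** * Laurent series *)

Section LaurentMaps.
Context (R S : comNzRingType).

(** With supports starting at -M and -N, the list covers -M <= i <= n + N. Vanishing is recorded
    factor by factor so that it passes to images of [f] and [g] under additive maps. *)
Lemma laurent_finsupp (T : comNzRingType) (f g : laurent T) (n : int) : exists2
  r : seq int, uniq r &
  forall i, i \notin r -> f i = 0 \/ g (n - i) = 0.
Proof.
have [[M fM] [N gN]] := (laurent_bound f, laurent_bound g).
exists [seq s%:Z - M%:Z | s <- iota 0 (absz (n + M%:Z + N%:Z + 1))].
  by rewrite map_inj_uniq ?iota_uniq // => a b; lia.
move=> i /mapP iP; have [iM|iM] := ltP i (- M%:Z); first by left; apply: fM.
right; apply: gN; rewrite ltNge; apply/negP => iN; apply: iP.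
by exists (absz (i + M%:Z)); rewrite ?mem_iota; lia.
Qed.

Lemma lcoefM (T : comNzRingType) (f g : laurent T) (n : int) (r : seq int) :
  uniq r ->
  (forall i, i \notin r -> f i = 0 \/ g (n - i) = 0) ->
  (f * g) n = \sum_(i <- r) f i * g (n - i).
Proof.
move=> ur fg; rewrite [LHS]/= /lmul_fun; apply: fsbigT_seq => // i /fg.
by case=> ->; rewrite ?mul0r ?mulr0.
Qed.

Lemma lmap_is_additive (V W : zmodType) (phi : {additive V -> W}) :
  additive (@lmap V W phi).
Proof. by move=> f g; apply: laurentP => i; exact: raddfB. Qed.

HB.instance Definition _ (V W : zmodType) (phi : {additive V -> W}) :=
  GRing.isAdditive.Build (laurent V) (laurent W) (@lmap V W phi)
    (lmap_is_additive phi).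

Lemma lderiv_is_additive : additive (@lderiv R).
Proof. by move=> f g; apply: laurentP => i; exact: mulrzBl. Qed.

HB.instance Definition _ :=
  GRing.isAdditive.Build (laurent R) (laurent R) (@lderiv R) lderiv_is_additive.

Lemma lmap_lderiv (phi : {additive R -> S}) f :
  lmap phi (lderiv f) = lderiv (lmap phi f).
Proof. by apply: laurentP => i; exact: raddfMz. Qed.

Lemma lmap_iter_lderiv (phi : {additive R -> S}) f a :
  lmap phi (iter a (@lderiv R) f) = iter a (@lderiv S) (lmap phi f).
Proof. by elim: a => //= a <-; exact: lmap_lderiv. Qed.

Lemma lmap_is_multiplicative (phi : {rmorphism R -> S}) :
  multiplicative (lmap phi).
Proof.
split=> [f g|]; last first.
  by apply: laurentP => i /=; rewrite rmorph_nat.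
apply: laurentP => n; have [r ur fg] := laurent_finsupp f g n.
transitivity (phi ((f * g) n)); first by [].
rewrite (lcoefM ur fg) (@lcoefM S (lmap phi f) (lmap phi g) n r) //.
  by rewrite rmorph_sum; apply: eq_bigr => i _ /=; rewrite rmorphM.
by move=> i /fg[] E; [left|right]; rewrite /= E rmorph0.
Qed.

HB.instance Definition _ (phi : {rmorphism R -> S}) :=
  GRing.isMultiplicative.Build (laurent R) (laurent S) (lmap phi)
    (lmap_is_multiplicative phi).

Lemma lmap_leibniz (D : {additive R -> R}) : leibniz D -> leibniz (lmap D).
Proof.
move=> DM f g; apply: laurentP => n; have [r ur fg] := laurent_finsupp f g n.
transitivity (D ((f * g) n)); first by [].
transitivity ((lmap D f * g) n + (f * lmap D g) n); last by [].
rewrite !(lcoefM ur) //.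
- by rewrite raddf_sum -big_split; apply: eq_bigr => i _ /=; rewrite DM.
- by move=> i /fg[] E; [left|right]; rewrite /= E ?raddf0.
- by move=> i /fg[] E; [left|right]; rewrite /= E ?raddf0.
Qed.

Lemma lderiv_leibniz : leibniz (@lderiv R).
Proof.
move=> f g; apply: laurentP => n.
have [r ur fg] := laurent_finsupp f g (n + 1).
transitivity ((f * g) (n + 1) *~ (n + 1)); first by [].
transitivity ((lderiv f * g) n + (f * lderiv g) n); last by [].
rewrite (lcoefM ur fg) (@lcoefM R f (lderiv g) n r) //; last first.
  move=> i /fg[] E; [by left|right]; rewrite /=.
  by rewrite (_ : n - i + 1 = n + 1 - i) ?E ?mul0rz //; ring.
(* The derivative moves f_i to position i - 1, hence the shifted list; f_i g_{n+1-i} then receives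
   the factors i and n + 1 - i, of sum n + 1. *)
rewrite (@lcoefM R (lderiv f) g n [seq i - 1 | i <- r]); first last.
- move=> i ir; have /fg : i + 1 \notin r.
    by apply: contra ir => ir; apply/mapP; exists (i + 1) => //; ring.
  case=> E; [left|right]; first by rewrite /= E mul0rz.
  by rewrite -E; congr (g _); ring.
- by rewrite map_inj_uniq // => i j /addIr.
rewrite big_map mulrz_suml -big_split; apply: eq_bigr => i _ /=.
rewrite subrK (_ : n - (i - 1) = n + 1 - i); last by ring.
rewrite (_ : n - i + 1 = n + 1 - i); last by ring.
by rewrite mulrzAl mulrzAr -mulrzDr; congr (_ *~ _); ring.
Qed.

End LaurentMaps.

(** * Restriction of polynomials to a set of variables *)

Lemma mcoeff_sum_filter (K : choiceType) (G : zmodType) (P : pred K)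
    (f : {malg G[K]}) b :
  (\sum_(a <- msupp f | P a) << f@_a *g a >>)@_b = if P b then f@_b else 0.
Proof.
rewrite raddf_sum /=.
have E a : << f@_a *g a >>@_b = if a == b then f@_b else 0.
  by rewrite mcoeffU; case: eqP => [->|].
under eq_bigr do rewrite E.
rewrite -big_mkcondr /=; have [bf|bf] := boolP (b \in msupp f); last first.
  by rewrite (mcoeff_outdom bf) if_same big1.
rewrite big_mkcond (big_fsetD1 _ bf) /= eqxx andbT big1_fset ?addr0 // => a.
by rewrite in_fsetD1 => /andP[/negPf->]; rewrite andbF.
Qed.

Section Restriction.
Context (R : comNzRingType) (I : choiceType) (Q : pred I).
Implicit Types (p q : {malg R[cmonom I]}) (a b : cmonom I).

Definition mon_in a : bool := all Q (finsupp a).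

Lemma mon_inM a b : mon_in (mmul a b) = mon_in a && mon_in b.
Proof.
rewrite /mon_in mdomD; apply/allP/andP => [ab|[/allP aQ /allP bQ] i].
  by split; apply/allP => i ia; apply: ab; rewrite inE ia ?orbT.
by rewrite inE => /orP[/aQ|/bQ].
Qed.

Lemma mon_inU i : mon_in (ucm i) = Q i.
Proof.
rewrite /mon_in mdomU; apply/allP/idP => [|Qi j]; first by apply; rewrite inE.
by rewrite inE => /eqP->.
Qed.

(** This substitutes 0 for the variables outside [Q]. For the condition i >= -n it is the transition
    map onto k[y_i | i >= -n]. *)
Definition mrestrict p : {malg R[cmonom I]} :=
  \sum_(a <- msupp p | mon_in a) << p@_a *g a >>.

Lemma mcoeff_mrestrict p b : (mrestrict p)@_b = if mon_in b then p@_b else 0.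
Proof. exact: mcoeff_sum_filter. Qed.

Lemma mrestrict_is_additive : additive mrestrict.
Proof.
move=> p q; apply: cmalgP => a; rewrite [LHS]mcoeff_mrestrict [RHS]mcoeffB.
rewrite [X in _ = X - _]mcoeff_mrestrict [X in _ = _ - X]mcoeff_mrestrict.
by rewrite (mcoeffB a p q); case: ifP => // _; rewrite subr0.
Qed.

HB.instance Definition _ := GRing.isAdditive.Build
  {malg R[cmonom I]} {malg R[cmonom I]} mrestrict mrestrict_is_additive.

Lemma mrestrictU (c : R) a :
  mrestrict << c *g a >> = if mon_in a then << c *g a >> else 0.
Proof.
rewrite /mrestrict msuppU; case: eqP => [->|_].
  by rewrite big_mkcond big_seq_fset0 monalgU0 if_same.
by rewrite big_mkcond big_seq_fset1 mcoeffUU.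
Qed.

Lemma msupp_mrestrict p a : a \in msupp (mrestrict p) -> mon_in a.
Proof.
rewrite -mcoeff_neq0 mcoeff_mrestrict.
by case: (mon_in a) => //; rewrite eqxx.
Qed.

End Restriction.

Section RestrictionMorphism.
Context (R : comNzRingType) (I : choiceType).
Implicit Types (p q : {malg R[cmonom I]}) (a b : cmonom I) (Q : pred I).
Local Opaque mpartial mrestrict.

(** By [mon_inM], a product of monomials survives exactly when both factors do. *)
Lemma mrestrict_is_multiplicative Q : multiplicative (@mrestrict R I Q).
Proof.
split=> [p q|]; last first.
  by rewrite [LHS]mrestrictU /mon_in mdom1.
apply: cmalgP => a; rewrite [LHS]mcoeff_mrestrict.
have sub p' : (msupp (mrestrict Q p') `<=` msupp p')%fset.
  apply/fsubsetP => b; rewrite -!mcoeff_neq0 mcoeff_mrestrict.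
  by case: ifP; rewrite ?eqxx.
rewrite [X in if _ then X else _]mcoeffMl [RHS](mcoeffMlw _ (sub p) (sub q)).
rewrite (_ : (if _ then _ else _) = \sum_(k1 <- msupp p) \sum_(k2 <- msupp q)
   (if mon_in Q a then (p@_k1 * q@_k2) *+ (mmul k1 k2 == a) else 0));
     last first.
  case: ifP => // _; rewrite big1 // => b _; exact: big1.
apply: eq_bigr => b _; apply: eq_bigr => c _.
rewrite !mcoeff_mrestrict; case: eqP => [<-|_]; last by rewrite !mulr0n if_same.
by rewrite mon_inM; case: (mon_in Q b); case: (mon_in Q c);
  rewrite ?mul0r ?mulr0.
Qed.

HB.instance Definition _ Q := GRing.isMultiplicative.Build
  {malg R[cmonom I]} {malg R[cmonom I]} (@mrestrict R I Q)
  (mrestrict_is_multiplicative Q).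

Lemma mpartial_mrestrict Q i p : Q i ->
  mpartial i (mrestrict Q p) = mrestrict Q (mpartial i p).
Proof.
move=> Qi; apply: cmalgP => b; rewrite [LHS]mcoeff_mpartial
  [RHS]mcoeff_mrestrict.
rewrite [X in X *+ _]mcoeff_mrestrict [X in _ = if _ then X else
  _]mcoeff_mpartial.
rewrite -[mulcm b _]/(mmul b _) mon_inM mon_inU Qi andbT.
by case: ifP => // _; rewrite mul0rn.
Qed.

Lemma mpartial_mrestrict0 Q i p : ~~ Q i -> mpartial i (mrestrict Q p) = 0.
Proof.
move=> Qi; apply: cmalgP => b; rewrite [LHS]mcoeff_mpartial [RHS]mcoeff0.
rewrite [X in X *+ _]mcoeff_mrestrict -[mulcm b _]/(mmul b _) mon_inM mon_inU.
by rewrite (negPf Qi) andbF mul0rn.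
Qed.

End RestrictionMorphism.

(** * The variational principle *)

Section MonomialSupport.
Context (R : comNzRingType) (I : choiceType).
Implicit Types (p q : {malg R[cmonom I]}) (a b : cmonom I).

Lemma malg_vars p : exists2 r : seq I, uniq r &
  forall a, a \in msupp p -> {subset finsupp a <= r}.
Proof.
exists (undup (flatten [seq enum_fset (finsupp a) | a <- enum_fset (msupp p)])).
  exact: undup_uniq.
move=> a ap i ia; rewrite mem_undup; apply/flattenP.
by exists (enum_fset (finsupp a)) => //; apply/mapP; exists a.
Qed.

Lemma mpartial_eq0 i p :
  (forall a, a \in msupp p -> i \notin finsupp a) -> mpartial i p = 0.
Proof.
move=> pi; rewrite /mpartial big_seq big1 // => a /pi.
by rewrite -cmE_eq0 => /eqP->; rewrite mulr0n monalgU0.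
Qed.

End MonomialSupport.

Lemma rmorph_mmap (R : comNzRingType) (I : choiceType) (S T : comNzRingType)
    (phi : {additive R -> S}) (g : I -> S) (psi : {rmorphism S -> T})
    (p : {malg R[cmonom I]}) :
  psi (mmap phi (mon_eval g) p) = mmap (psi \o phi) (mon_eval (psi \o g)) p.
Proof.
rewrite !mmapE rmorph_sum; apply: eq_bigr => a _.
rewrite rmorphM rmorph_prod; congr (_ * _); apply: eq_bigr => i _.
by rewrite rmorphXn.
Qed.

Section Variation.
Context (k : fieldType).
Implicit Types (E D : diffalg k) (n : nat).
Local Opaque mpartial mrestrict.

Local Notation loop_jet n := (fun a => iter a (@lderiv (ypoly k)) (generic_loop
  k n)).
Local Notation phi := (lmap (@malgC (cmonom int) k)).

Lemma eval_loopE E n : eval_loop E n = mmap phi (mon_eval (loop_jet n)) E.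
Proof. by []. Qed.

Lemma dzE E (r : seq nat) : uniq r ->
  (forall a, a \in msupp E -> {subset finsupp a <= r}) ->
  dz E = \sum_(a <- msupp E) << lderiv E@_a *g a >>
         + \sum_(i <- r) jvar k i.+1 * mpartial i E.
Proof.
move=> ur Er; rewrite /dz; apply: (congr2 +%R) => //.
apply: fsbigT_seq => // i ir; rewrite mpartial_eq0 ?mulr0 // => a /Er ar.
by apply: contra ir; apply: ar.
Qed.

(** Both sides expand in the same way: [dz] replaces x_i by x_{i+1}, whose value is the derivative
    of the value of x_i. *)
Lemma eval_loop_dz E n : eval_loop (dz E) n = lderiv (eval_loop E n).
Proof.
have [r ur Er] := malg_vars E; rewrite (dzE ur Er) !eval_loopE.
rewrite (mmap_chain_rule _ _ (@lderiv_leibniz _) ur Er) raddfD.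
apply: (congr2 +%R); rewrite raddf_sum; apply: eq_bigr => i _ /=.
  by rewrite mmapU -lmap_lderiv.
by rewrite mmap_mulU mulrC.
Qed.

Lemma eval_loop_iter_dz E n a :
  eval_loop (iter a (@dz k) E) n = iter a (@lderiv _) (eval_loop E n).
Proof. by elim: a => //= a <-; exact: eval_loop_dz. Qed.

Lemma eval_loop_variational D n (r : seq nat) : uniq r ->
  (forall a, a \in msupp D -> {subset finsupp a <= r}) ->
  eval_loop (variational_derivative D) n = \sum_(i <- r)
    (-1) ^+ i * iter i (@lderiv _) (eval_loop (mpartial i D) n).
Proof.
move=> ur Dr; rewrite /variational_derivative (@fsbigT_seq _ _ r) //;
  last first.
  move=> i ir; rewrite mpartial_eq0 => [|a /Dr ar]; last first.
    by apply: contra ir; apply: ar.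
  have -> : iter i (@dz k) 0 = 0; last by rewrite mulr0.
  elim: i {ir} => //= i ->; rewrite (@dzE 0 [::]) // ?msupp0 //.
  by rewrite big_seq_fset0 big_nil addr0.
rewrite eval_loopE raddf_sum; apply: eq_bigr => i _.
by rewrite raddfMsign -eval_loop_iter_dz.
Qed.

(** A named coefficient map, able to carry an additive structure; at j = -1 it is the residue. *)
Definition lcoef_at (V : zmodType) (j : int) (f : laurent V) : V := f j.

Lemma lcoef_at_is_additive (V : zmodType) (j : int) : additive (@lcoef_at V j).
Proof. by []. Qed.

HB.instance Definition _ (V : zmodType) (j : int) :=
  GRing.isAdditive.Build (laurent V) V (@lcoef_at V j)
    (@lcoef_at_is_additive V j).

Lemma residue_lderiv (R : comNzRingType) (f : laurent R) : lderiv f (-1) = 0.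
Proof. exact: mulr0z. Qed.

Lemma mpartial_malgC i (c : laurent k) : lmap (@mpartial k int i) (phi c) = 0.
Proof.
apply: laurentP => j; transitivity (mpartial i (<< c j *g mone >> : ypoly k));
  first by [].
by rewrite [LHS]mpartialU cm1 mulr0n monalgU0.
Qed.

(** The derivative of y(z) by y_i is z^i, as long as y_i is not set to 0 at level [n]. *)
Lemma mpartial_generic_loop i n (j : int) : - n%:Z <= i ->
  lmap (@mpartial k int i) (generic_loop k n) j = (j == i)%:R.
Proof.
move=> ni; rewrite /=; case: ifPn => [nj|nj]; last first.
  by rewrite raddf0; case: eqP nj => // ->; rewrite ni.
rewrite [LHS]mpartialU cmU; case: eqP => [->|_];
  last by rewrite mulr0n monalgU0.
suff -> : divcm (ucm i) (ucm i) = mone by [].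
by apply/eqP/cmP => l; rewrite divcmE subnn cm1.
Qed.

Lemma Ecoef_variational D n (i : int) : - n%:Z <= i ->
  Ecoef (variational_derivative D) (-1 - i) n = mpartial i (Ecoef D (-1) n).
Proof.
move=> ni; have [r ur Dr] := malg_vars D.
pose zi := lmap (@mpartial k int i) (generic_loop k n).
have L : leibniz (lmap (@mpartial k int i)) by apply: lmap_leibniz => p q;
  exact: mpartialM.
(* [zi] is z^i, so multiplication by it brings the coefficient of index -1 - i into the residue. *)
transitivity (lcoef_at (-1) (eval_loop (variational_derivative D) n * zi)).
  rewrite /lcoef_at (@lcoefM _ _ _ _ [:: -1 - i]) //; last first.
    move=> j; rewrite inE => ji; right; rewrite mpartial_generic_loop //.
    by case: eqP => // e; move/eqP: ji; case; lia.
  rewrite big_seq1 mpartial_generic_loop // (_ : -1 - (-1 - i) = i) ?eqxx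
    ?mulr1 //.
  by ring.
transitivity (lcoef_at (-1) (lmap (@mpartial k int i) (eval_loop D n)));
  last by [].
rewrite (eval_loop_variational _ ur Dr) eval_loopE (mmap_chain_rule _ _ L ur
  Dr).
rewrite [X in X + _]big1 ?add0r; last first.
  by move=> a _; rewrite [X in X * _]mpartial_malgC mul0r.
rewrite mulr_suml !raddf_sum.
apply: eq_bigr => a _.
have := leibniz_iter_residue (@lderiv_leibniz (ypoly k)) a
  (eval_loop (mpartial a D) n) zi (@residue_lderiv (ypoly k)
  : forall z, lcoef_at (-1) (lderiv z) = 0).
(* d/dz commutes with d/dy_i: the a-th derivative of z^i is d/dy_i of the a-th derivative of
   y(z). *)
have -> : iter a (@lderiv (ypoly k)) zi = lmap (@mpartial k int i) (loop_jet n
  a).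
  by symmetry; exact: lmap_iter_lderiv.
by move=> H; exact: (esym H).
Qed.

(** Restriction is a ring morphism that fixes constants, commutes with d/dz and carries the generic
    loop of level [N] to that of level [n]; evaluation is natural for it. *)
Lemma Ecoef_restrict E (j : int) (n N : nat) : (n <= N)%N ->
  mrestrict (fun i : int => - n%:Z <= i) (Ecoef E j N) = Ecoef E j n.
Proof.
move=> nN; pose Q := fun i : int => - n%:Z <= i.
transitivity (lmap (@mrestrict k int Q) (eval_loop E N) j); first by [].
suff -> : lmap (@mrestrict k int Q) (eval_loop E N) = eval_loop E n by [].
rewrite !eval_loopE rmorph_mmap !mmapE; apply: eq_bigr => a _; congr (_ * _).
  apply: laurentP => i; transitivity (mrestrict Q (<< E@_a i *g mone >> : ypoly
    k)); first by [].
  by rewrite [LHS]mrestrictU /mon_in mdom1.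
rewrite /mon_eval; apply: eq_bigr => i _; congr (_ ^+ _).
rewrite /= lmap_iter_lderiv; congr (iter _ _ _); apply: laurentP => l /=.
case: ifPn => [Nl|Nl]; last first.
  by rewrite raddf0 ifF //; apply/negP => nl; move: Nl;
    rewrite (le_trans _ nl) //; lia.
by rewrite [LHS]mrestrictU mon_inU.
Qed.

End Variation.

(** * Superpolynomials *)

Section SupportSums.
Context (K : choiceType) (G V : zmodType) (T : K -> G -> V).
Hypothesis TB : forall a, additive (T a).

Lemma msum_widen (d : {fset K}) (f : {malg G[K]}) : (msupp f `<=` d)%fset ->
  \sum_(a <- msupp f) T a f@_a = \sum_(a <- d) T a f@_a.
Proof.
move=> fd; apply: big_fset_incl => // a _ /mcoeff_outdom ->.
by rewrite -(subrr (0 : G)) TB subrr.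
Qed.

(** Sums over supports are compared on the union of the supports. This gives the additivity of the
    partial derivatives and of [poly_dR]. *)
Lemma msum_is_additive :
  additive (fun f : {malg G[K]} => \sum_(a <- msupp f) T a f@_a).
Proof.
move=> f g; pose d := (msupp f `|` msupp g)%fset.
rewrite !(@msum_widen d) ?fsubsetUl ?fsubsetUr ?msuppB_le // -sumrB.
by apply: eq_bigr => a _; rewrite mcoeffB TB.
Qed.

Lemma msumU c a : \sum_(b <- msupp << c *g a >>) T b << c *g a >>@_b = T a c.
Proof. by rewrite (msum_widen msuppU_le) big_seq_fset1 mcoeffUU. Qed.

End SupportSums.

Section SuperPolyTheory.
Context (R : comNzRingType) (I : countType) (odd : pred I).
Local Notation mon := (smonom odd).
Local Notation SP := (spoly R odd).
Implicit Types (f g h : {malg R[mon]}) (a b c : mon) (i j : I) (Q : pred I).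

Let lterm i a (x : R) : {malg R[mon]} :=
  << x * (-1) ^+ inversions odd (ucm i) (val (smon_div a i)) *+ val a i
     *g smon_div a i >>.

Let rterm i a (x : R) : {malg R[mon]} :=
  << x * (-1) ^+ inversions odd (val (smon_div a i)) (ucm i) *+ val a i
     *g smon_div a i >>.

Let lterm_is_additive i a : additive (lterm i a).
Proof. by move=> x y; rewrite /lterm mulrBl mulrnBl monalgUB. Qed.

Let rterm_is_additive i a : additive (rterm i a).
Proof. by move=> x y; rewrite /rterm mulrBl mulrnBl monalgUB. Qed.

Lemma lpartial_is_additive i : additive (@lpartial R I odd i).
Proof. by move=> f g; exact: (msum_is_additive (lterm_is_additive i)). Qed.

HB.instance Definition _ i := GRing.isAdditive.Build {malg R[mon]} {malg R[mon]}
  (@lpartial R I odd i) (lpartial_is_additive i).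

Lemma rpartial_is_additive i : additive (@rpartial R I odd i).
Proof. by move=> f g; exact: (msum_is_additive (rterm_is_additive i)). Qed.

HB.instance Definition _ i := GRing.isAdditive.Build {malg R[mon]} {malg R[mon]}
  (@rpartial R I odd i) (rpartial_is_additive i).

Lemma lpartialU i (x : R) a : lpartial i << x *g a >> =
  << x * (-1) ^+ inversions odd (ucm i) (val (smon_div a i)) *+ val a i
     *g smon_div a i >>.
Proof. exact: (msumU (lterm_is_additive i)). Qed.

Lemma rpartialU i (x : R) a : rpartial i << x *g a >> =
  << x * (-1) ^+ inversions odd (val (smon_div a i)) (ucm i) *+ val a i
     *g smon_div a i >>.
Proof. exact: (msumU (rterm_is_additive i)). Qed.

(** According to [Q], this expresses membership in [A_], evenness, absence of a kind of generators,
    or a finite list of variables. *)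
Definition supported Q f := forall a, a \in msupp f -> mon_in Q (val a).

Lemma supported0 Q : supported Q 0.
Proof. by move=> a; rewrite msupp0 inE. Qed.

Lemma supportedD Q f g : supported Q f -> supported Q g -> supported Q (f + g).
Proof.
move=> fQ gQ a af; have := fsubsetP (msuppD_le f g) a af.
by rewrite inE => /orP[/fQ|/gQ].
Qed.

Lemma supportedN Q f : supported Q f -> supported Q (- f).
Proof. by move=> fQ a; rewrite msuppN; exact: fQ. Qed.

Lemma supported_sum Q (J : eqType) (r : seq J) (F : J -> {malg R[mon]}) :
  (forall t, t \in r -> supported Q (F t)) -> supported Q (\sum_(t <- r) F t).
Proof.
move=> FQ; rewrite big_seq; apply: big_ind => //; first exact: supported0.
by move=> f g fQ gQ; exact: supportedD.
Qed.

Lemma supportedU Q (x : R) a : mon_in Q (val a) -> supported Q << x *g a >>.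
Proof. by move=> aQ b /(fsubsetP msuppU_le); rewrite inE => /eqP->. Qed.

Lemma supportedZ Q (x : R) f : supported Q f -> supported Q (x *: f).
Proof. by move=> fQ a /(fsubsetP (msuppZ_le _ _)); exact: fQ. Qed.

Lemma supportedM Q f g : supported Q f -> supported Q g ->
  supported Q (spmul f g).
Proof.
move=> fQ gQ; rewrite spmulE; apply: supported_sum => a /fQ aQ.
apply: supported_sum => b /gQ bQ; apply: supportedZ.
rewrite /mulmon smon_ofE; case: insubP => [c _ cE|_]; last exact: supported0.
by apply: supportedU; rewrite cE mon_inM aQ bQ.
Qed.

Lemma supported_lpartial Q i f : supported Q f -> supported Q (lpartial i f).
Proof.
move=> fQ; apply: supported_sum => a /fQ aQ; apply: supportedU.
apply/allP => j; rewrite -cmE_neq0 /= divcmE => aj; apply: (allP aQ).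
by rewrite -cmE_neq0; apply: contraNN aj => /eqP->; rewrite sub0n.
Qed.

Lemma lpartial_eq0 Q i f : supported Q f -> ~~ Q i -> lpartial i f = 0.
Proof.
move=> fQ Qi; rewrite /lpartial big_seq big1 // => a /fQ aQ.
have /eqP -> : val a i == 0%N.
  by rewrite cmE_eq0; apply: contra Qi => ia; exact: (allP aQ).
by rewrite mulr0n monalgU0.
Qed.

Lemma sderivationE (phi : I -> {malg R[mon]}) f (r : seq I) : uniq r ->
  (forall i, i \notin r -> phi i = 0 \/ lpartial i f = 0) ->
  sderivation phi f = \sum_(i <- r) spmul (phi i) (lpartial i f).
Proof.
move=> ur fr; apply: fsbigT_seq => // i /fr[] ->; first exact: spmul0l.
exact: spmul0r.
Qed.

Lemma spoly_vars f : exists2 r : seq I, uniq r & supported (mem r) f.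
Proof.
exists (undup (flatten [seq enum_fset (finsupp (val a)) | a <- enum_fset (msupp
  f)])).
  exact: undup_uniq.
move=> a af; apply/allP => i ia; rewrite /= mem_undup; apply/flattenP.
by exists (enum_fset (finsupp (val a))) => //; apply/mapP; exists a.
Qed.

Lemma supported_sderivation Q (phi : I -> {malg R[mon]}) f :
  (forall i, Q i -> supported Q (phi i)) -> supported Q f ->
  supported Q (sderivation phi f).
Proof.
move=> phiQ fQ; have [r ur fr] := spoly_vars f.
have fQr : supported (fun i => Q i && (i \in r)) f.
  move=> a af; apply/allP => i ia.
  by apply/andP; split; [exact: (allP (fQ _ af)) | exact: (allP (fr _ af))].
(* [phi i] is controlled only when [Q i] holds; the other variables do not occur in [f], so the
   derivation is summed without them. *)
rewrite (@sderivationE _ _ [seq i <- r | Q i]) ?filter_uniq //; last first.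
  move=> i; rewrite mem_filter => ir; right.
  exact: (@lpartial_eq0 (fun i => Q i && (i \in r))).
apply: supported_sum => i; rewrite mem_filter => /andP[Qi _].
by apply: supportedM; [exact: phiQ | exact: supported_lpartial].
Qed.

Lemma sderivation0 phi : @sderivation R I odd phi 0 = 0.
Proof.
rewrite (@sderivationE phi 0 [::]) ?big_nil // => i _; right.
exact: raddf0.
Qed.

Lemma spUM (x y : R) a b c : val c = mmul (val a) (val b) ->
  spmul << x *g a >> << y *g b >> =
  << x * y * (-1) ^+ inversions odd (val a) (val b) *g c >>.
Proof.
move=> cE; rewrite [LHS]spmulUU /mulmon [LHS]scale_smon -cE smon_ofE.
by rewrite valK.
Qed.

Lemma spUM_even (x y : R) a b c : val c = mmul (val a) (val b) ->
  inversions odd (val a) (val b) = 0%N ->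
  spmul << x *g a >> << y *g b >> = << x * y *g c >>.
Proof. by move=> cE ab; rewrite (spUM _ _ cE) ab mulr1. Qed.

Lemma spU_comm (x y : R) a b :
  inversions odd (val a) (val b) = 0%N -> inversions odd (val b) (val a) = 0%N
    ->
  spmul << x *g a >> << y *g b >> = spmul << y *g b >> << x *g a >>.
Proof.
move=> ab ba; rewrite [LHS]spmulUU [RHS]spmulUU /mulmon ab ba mulmC.
by rewrite (mulrC x).
Qed.

Lemma inversions_even (d m : {cmonom I}) : mon_in (fun i => ~~ odd i) d ->
  inversions odd d m = 0%N /\ inversions odd m d = 0%N.
Proof.
move=> /allP d0; rewrite /inversions; split.
  by rewrite big_seq_cond big1 // => i /andP[/d0 /negPf->].
rewrite big1 // => i _; rewrite big_seq_cond big1 // => j /andP[/d0 /negPf->].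
by [].
Qed.

Lemma even_comm f i : supported (fun i => ~~ odd i) f ->
  spmul f (spvar R odd i) = spmul (spvar R odd i) f.
Proof.
move=> f0; rewrite (monalgE f).
pose x := spvar R odd i; rewrite -/x.
rewrite (big_morph (fun g => spmul g x) (fun g h => @spmulDl R I odd g h x)
  (@spmul0l R I odd x)).
rewrite [RHS](big_morph (fun g => spmul x g) (fun g h => @spmulDr R I odd x g
  h) (@spmul0r R I odd x)).
apply: eq_big_seq => a /f0 a0; apply: spU_comm.
  exact: (inversions_even _ a0).1.
exact: (inversions_even _ a0).2.
Qed.

Lemma inversionsUU i j : odd i -> odd j ->
  inversions odd (ucm i) (ucm j) = (choice.pickle j < choice.pickle i)%N.
Proof.
move=> oi oj; rewrite /inversions !mdomU big_mkcond big_seq_fset1 oi.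
rewrite big_mkcond big_seq_fset1 oj /= cmUU.
by case: ltnP => //=; rewrite cmUU.
Qed.

Lemma spvar_sqr i : odd i -> spmul (spvar R odd i) (spvar R odd i) = 0.
Proof.
move=> oi; rewrite [LHS]spmulUU /mulmon smon_ofE insubF ?scaler0 //.
by apply/negP => /sqfreeP /(_ i oi); rewrite cmM cmUU.
Qed.

Lemma spvar_anticomm i j : odd i -> odd j ->
  spmul (spvar R odd i) (spvar R odd j) = - spmul (spvar R odd j) (spvar R odd
    i).
Proof.
move=> oi oj; have [->|ij] := eqVneq i j; first by rewrite spvar_sqr // oppr0.
rewrite [LHS]spmulUU [X in _ = - X]spmulUU /mulmon [LHS]scale_smon.
rewrite [X in _ = - X]scale_smon.
rewrite !inversionsUU // (mulmC (ucm i)) !smon_ofE; case: insubP => [c _ _|_].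
  rewrite -monalgUN !mul1r; congr (<< _ *g _ >>).
  (* Since [pickle] is injective, exactly one of the two orders is an inversion, whence opposite
     signs. *)
  have pij : choice.pickle i != choice.pickle j.
    by apply: contra ij => /eqP /(pcan_inj choice.pickleK) ->.
  by move: pij; case: ltngtP => // _ _; rewrite ?expr0 ?expr1 ?opprK.
by rewrite oppr0.
Qed.

End SuperPolyTheory.

Section Counting.
Context (I : choiceType) (P : pred I).
Implicit Types (a b : {cmonom I}).

(** Both [weight] and, up to sign, [degree] are of this form, so [mcountM] computes them on
    products. *)
Definition mcount a := (\sum_(i <- finsupp a | P i) a i)%N.

Lemma mcountE (d : {fset I}) a : (finsupp a `<=` d)%fset ->
  mcount a = (\sum_(i <- d | P i) a i)%N.
Proof.
move=> ad; rewrite /mcount big_mkcond [RHS]big_mkcond.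
apply: big_fset_incl => // i _; rewrite -cmE_eq0 => /eqP->.
by rewrite if_same.
Qed.

Lemma mcountM a b : mcount (mmul a b) = (mcount a + mcount b)%N.
Proof.
pose d := (finsupp a `|` finsupp b)%fset.
rewrite !(@mcountE d) ?fsubsetUl ?fsubsetUr ?mdomD //.
by rewrite -big_split; apply: eq_bigr => i _; rewrite cmM.
Qed.

Lemma mcountU i : mcount (ucm i) = P i.
Proof. by rewrite /mcount mdomU big_mkcond big_seq_fset1 cmUU; case: (P i). Qed.

Lemma mcount_eq0 a : (mcount a == 0)%N = mon_in (fun i => ~~ P i) a.
Proof.
rewrite /mcount big_mkcond sum_nat_seq_eq0; apply: eq_in_all => i.
by rewrite /= -cmE_neq0; case: (P i) => // /negPf->.
Qed.

End Counting.

(** * Polynomials as forms of weight zero *)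

Lemma additive_eqD (U V : zmodType) (F G : {additive U -> V}) p q :
  F p = G p -> F q = G q -> F (p + q) = G (p + q).
Proof. by rewrite !raddfD => -> ->. Qed.

Section PolynomialForms.
Context (k : fieldType).
Implicit Types (p q : ypoly k) (a b : cmonom int) (i j : int).
Local Notation mon := (smonom dR_odd).

Definition ycm a : cmonom dRgen :=
  [cmonom (if g is (false, Yv i) then a i else 0%N)
    | g in [fset ((false, Yv i) : dRgen) | i in finsupp a]%fset]%M.

Lemma ycmE a (g : dRgen) :
  ycm a g = if g is (false, Yv i) then a i else 0%N.
Proof.
rewrite cmE fsfun_fun; case: ifPn => // gN.
case: g gN => [[] [i|j]] //= gN; apply/esym/eqP; rewrite cmE_eq0.
by apply: contra gN => ia; apply/imfsetP; exists i.
Qed.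

Lemma ycm_sqfree a : sqfree dR_odd (ycm a).
Proof. by apply/sqfreeP => -[[] [i|j]] //; rewrite ycmE. Qed.

Definition ymon a : mon := exist (fun m => sqfree dR_odd m) _ (ycm_sqfree a).

Lemma ycmM a b : ycm (mmul a b) = mmul (ycm a) (ycm b).
Proof.
by apply/eqP/cmP => -[[] [i|j]]; rewrite cmM !ycmE ?cmM.
Qed.

Lemma ycm1 : ycm mone = mone.
Proof. by apply/eqP/cmP => -[[] [i|j]]; rewrite cm1 ycmE ?cm1. Qed.

Lemma ycmU i : ycm (ucm i) = ucm (false, Yv i).
Proof.
by apply/eqP/cmP => -[[] [l|j]]; rewrite ycmE cmU // cmU; congr (nat_of_bool _);
  apply/eqP/eqP => [->|[]].
Qed.

Lemma mon_in_ycm (Q : pred dRgen) a :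
  mon_in Q (ycm a) = mon_in (fun i => Q (false, Yv i)) a.
Proof.
apply/allP/allP => aQ => [i|[[] [i|j]]].
- by rewrite -cmE_neq0 => ai; apply: aQ; rewrite -cmE_neq0 ycmE.
all: rewrite -cmE_neq0 ycmE //.
by rewrite cmE_neq0 => /aQ.
Qed.

Lemma ymon_even a : mon_in (fun g => ~~ dR_odd g) (val (ymon a)).
Proof. by rewrite mon_in_ycm; apply/allP. Qed.

Local Notation ym a := (<< ymon a >> : dR k).

Lemma ymonM a b : ym (mmul a b) = ym a * ym b.
Proof.
symmetry; rewrite -[X in << X *g ymon (mmul a b) >>]mulr1.
apply: spUM_even; first exact: ycmM.
by have [] := inversions_even (ycm b) (ymon_even a).
Qed.

Lemma ymon1 : ym mone = 1.
Proof.
suff -> : ymon mone = smon1 dR_odd by [].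
by apply: val_inj; exact: ycm1.
Qed.

Lemma gen_ymon i : gen k (Yv i) = ym (ucm i).
Proof.
suff -> : ymon (ucm i) = smonU dR_odd (false, Yv i) by [].
by apply: val_inj; exact: ycmU.
Qed.

Lemma gen_prod a :
  \prod_(i <- finsupp a) gen k (Yv i) ^+ a i = ym a.
Proof.
pose pw i := iter (a i) (mmul (ucm i)) mone.
transitivity (\prod_(i <- finsupp a) ym (pw i)).
  apply: eq_bigr => i _; rewrite /pw gen_ymon.
  elim: (a i) => [|t IH]; first by rewrite expr0 [RHS]ymon1.
  by rewrite exprS IH iterS [RHS]ymonM.
rewrite -(big_morph (fun b => ym b) ymonM ymon1); congr << ymon _ >>.
have pwE i j : pw i j = ((i == j) * a i)%N.
  rewrite /pw; elim: (a i) => [|t IH]; first by rewrite cm1 muln0.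
  by rewrite iterS cmM IH cmU mulnS.
apply/eqP/cmP => j; rewrite (big_morph (fun b : cmonom int => b j)
  (fun b c => cmM j b c) (cm1 j)).
under eq_bigr do rewrite pwE.
have [ja|ja] := boolP (j \in finsupp a); last first.
  rewrite big_seq big1 => [|i ia]; last by case: eqP ja ia => // -> /negPf->.
  by apply/esym/eqP; rewrite cmE_eq0.
rewrite (big_fsetD1 _ ja) /= eqxx mul1n big1_fset ?addn0 // => i.
by rewrite in_fsetD1 => /andP[/negPf->].
Qed.

(** The y_i are even, so their products incur no sign and [poly_dR] merely relabels monomials;
    parity, truncation and d/dy_i can then be read off. *)
Lemma poly_dRE p : poly_dR p = \sum_(a <- msupp p) << p@_a *g ymon a >>.
Proof.
rewrite /poly_dR mmapE; apply: eq_bigr => a _; rewrite gen_prod.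
transitivity (spmul << p@_a *g smon1 dR_odd >> << 1 *g ymon a >>).
  apply: (congr1 (fun x : dR k => x * ym a)).
  by rewrite [LHS]scaleU mulr1.
rewrite [LHS](@spUM_even _ _ _ _ _ _ _ (ymon a)) ?mulr1 //.
  by rewrite mul1m.
exact: inversions1l.
Qed.

Lemma poly_dR_is_additive : additive (@poly_dR k).
Proof.
move=> p q; rewrite !poly_dRE.
apply: (msum_is_additive (T := fun a (c : k) => (<< c *g ymon a >> : dR k))).
by move=> a x y; exact: monalgUB.
Qed.

HB.instance Definition _ :=
  GRing.isAdditive.Build (ypoly k) (dR k) (@poly_dR k) poly_dR_is_additive.

Lemma poly_dRU (c : k) a : poly_dR << c *g a >> = << c *g ymon a >>.
Proof.
rewrite [LHS]poly_dRE.
apply: (msumU (T := fun a (c : k) => (<< c *g ymon a >> : dR k))).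
by move=> b x y; exact: monalgUB.
Qed.

Lemma poly_dR_even p : supported (fun g => ~~ dR_odd g) (poly_dR p).
Proof.
rewrite poly_dRE; apply: supported_sum => a _; apply: supportedU.
exact: ymon_even.
Qed.

Lemma lpartial_poly_dR i p :
  lpartial (false, Yv i) (poly_dR p) = poly_dR (mpartial i p).
Proof.
elim/cmalg_ind: p => [|p q IHp IHq|c a]; first by rewrite !raddf0.
  exact: (@additive_eqD (ypoly k) (dR k)
    (@lpartial k dRgen dR_odd (false, Yv i) \o @poly_dR k)
    (@poly_dR k \o @mpartial k int i) p q IHp IHq).
rewrite [X in lpartial _ X]poly_dRU [LHS]lpartialU [X in _ = poly_dR
  X]mpartialU.
rewrite [RHS]poly_dRU /= ycmE.
have -> : smon_div (ymon a) (false, Yv i) = ymon (divcm a (ucm i)).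
  apply: val_inj; apply/eqP/cmP => -[[] [l|j]];
    rewrite /= divcmE !ycmE ?sub0n //.
  by rewrite divcmE !cmU.
by rewrite (inversions_even _ _).1 ?mulr1 // mon_inU.
Qed.

Lemma d_dR_poly_dR (r : seq int) p : uniq r ->
  (forall l, l \notin r -> mpartial l p = 0) ->
  d_dR (poly_dR p) =
  \sum_(l <- r) dgen k (Yv l) * poly_dR (mpartial l p).
Proof.
move=> ur pr; rewrite /d_dR (@sderivationE _ _ _ _ _ [seq (false, Yv l) | l <-
  r]).
- by rewrite big_map; apply: eq_bigr => l _;
  rewrite [X in spmul _ X]lpartial_poly_dR.
- by rewrite map_inj_uniq // => l l' [].
(* [d_dR] kills the generators dv, and no xi_j occurs in a polynomial in the y_i. *)
move=> [[] [l|j]] lr; [by left|by left|right|right].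
  rewrite [LHS]lpartial_poly_dR pr ?raddf0 //.
  by apply: contra lr => lr; apply/mapP; exists l.
apply: (@lpartial_eq0 _ _ _ (fun g => ~~ is_xi g.2)) => //.
rewrite poly_dRE; apply: supported_sum => a _; apply: supportedU.
by rewrite mon_in_ycm; apply/allP.
Qed.

End PolynomialForms.

(** * Levels and Jacobians *)

Section Levels.
Context (k : fieldType) (m : nat -> int).
Implicit Types (p q : ypoly k) (f g : dR k) (n N : nat) (i j : int).
Local Notation mon := (smonom dR_odd).

Definition level_gen n (g : dRgen) : bool := in_level m n g.2 && ~~ g.1.

Lemma A_supported n f : A_ m n f <-> supported (level_gen n) f.
Proof.
have E (a : mon) : mon_in (level_gen n) (val a) = mon_level m n a && (weight a
  == 0)%N.
  rewrite -[weight a]/(mcount _ _) mcount_eq0 -[mon_level m n a]/(mon_in _ _).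
  by rewrite /mon_in -all_predI.
split=> fA a /fA; first by case=> la wa; rewrite E la wa eqxx.
by rewrite E => /andP[la /eqP].
Qed.

Lemma A_0 n : A_ m n (0 : dR k).
Proof. by apply/A_supported; exact: supported0. Qed.

Lemma A_D n f g : A_ m n f -> A_ m n g -> A_ m n (f + g).
Proof. by move=> /A_supported fA /A_supported gA; apply/A_supported;
  exact: supportedD. Qed.

Lemma A_N n f : A_ m n f -> A_ m n (- f).
Proof. by move=> /A_supported fA; apply/A_supported; exact: supportedN. Qed.

Lemma A_M n f g : A_ m n f -> A_ m n g -> A_ m n (f * g).
Proof. by move=> /A_supported fA /A_supported gA; apply/A_supported;
  exact: supportedM. Qed.

Lemma A_1 n : A_ m n (1 : dR k).
Proof.
by apply/A_supported; apply: supportedU; rewrite /mon_in mdom1; apply/allP.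
Qed.

Lemma A_sum n (J : eqType) (r : seq J) (F : J -> dR k) :
  (forall t, t \in r -> A_ m n (F t)) -> A_ m n (\sum_(t <- r) F t).
Proof.
by move=> FA; apply/A_supported; apply: supported_sum => t tr;
  apply/A_supported/FA.
Qed.

Lemma sgn_inv0 : sgn_inv (0 : dR k) = 0.
Proof. by rewrite /sgn_inv msupp0 big_seq_fset0. Qed.

Lemma A_sgn_inv n f : A_ m n f -> A_ m n (sgn_inv f).
Proof.
move=> /A_supported fA; apply/A_supported; apply: supported_sum => a /fA aQ.
exact: supportedU.
Qed.

Lemma mcoeff_truncate n f (a : mon) :
  (truncate m n f)@_a = if mon_level m n a then f@_a else 0.
Proof. exact: mcoeff_sum_filter. Qed.

Lemma truncate_is_additive n : additive (@truncate k m n).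
Proof.
move=> f g; apply: (malgP _ _).1 => a.
rewrite [LHS]mcoeff_truncate [RHS]mcoeffB [X in _ = X - _]mcoeff_truncate.
rewrite [X in _ = _ - X]mcoeff_truncate [X in if _ then X else _]mcoeffB.
by case: ifP => // _; rewrite subr0.
Qed.

HB.instance Definition _ n :=
  GRing.isAdditive.Build (dR k) (dR k) (@truncate k m n) (truncate_is_additive
    n).

Lemma truncateU n (c : k) (a : mon) :
  truncate m n << c *g a >> = if mon_level m n a then << c *g a >> else 0.
Proof.
rewrite /truncate /sfilter msuppU; case: eqP => [->|_].
  by rewrite big_mkcond big_seq_fset0 monalgU0 if_same.
by rewrite big_mkcond big_seq_fset1 mcoeffUU.
Qed.

Lemma truncate_poly_dR n p :
  truncate m n (poly_dR p) = poly_dR (mrestrict (fun i => - n%:Z <= i) p).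
Proof.
elim/cmalg_ind: p => [|p q IHp IHq|c a]; first by rewrite !raddf0.
  exact: (@additive_eqD (ypoly k) (dR k) (@truncate k m n \o @poly_dR k)
    (@poly_dR k \o @mrestrict k int _) p q IHp IHq).
rewrite [X in truncate _ _ X]poly_dRU [LHS]truncateU [X in _ = poly_dR
  X]mrestrictU.
rewrite -[mon_level _ _ _]/(mon_in _ (ycm a)) mon_in_ycm /=.
by case: ifP => _; rewrite ?raddf0 // [RHS]poly_dRU.
Qed.

Lemma A_poly_dR n p : mrestrict (fun i => - n%:Z <= i) p = p -> A_ m n (poly_dR
  p).
Proof.
move=> pn; apply/A_supported; rewrite poly_dRE; apply: supported_sum => a.
rewrite -pn => /msupp_mrestrict an; apply: supportedU; rewrite mon_in_ycm.
by apply/allP => i ia; rewrite /level_gen /= (allP an).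
Qed.

Section Equation.
Context (E : diffalg k) (m_adm : admissible E m).

Lemma in_levelW n N v : (n <= N)%N -> in_level m n v -> in_level m N v.
Proof.
move=> nN; case: v => i /= iv; first by lia.
by apply: le_trans iv; rewrite lerN2; exact: (admissible_mono m_adm).
Qed.

Lemma level_exists (B : int) : exists n, B <= m n.
Proof. exact: (admissible_cofinal m_adm). Qed.

Lemma mrestrictW n N p : (n <= N)%N ->
  mrestrict (fun i => - n%:Z <= i) (mrestrict (fun i => - N%:Z <= i) p) =
  mrestrict (fun i => - n%:Z <= i) p.
Proof.
move=> nN; apply: cmalgP => a; rewrite [LHS]mcoeff_mrestrict
  [RHS]mcoeff_mrestrict.
rewrite [X in if _ then X else _]mcoeff_mrestrict; case: ifP => // an;
  rewrite ifT //.
by apply/allP => i /(allP an); lia.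
Qed.

(** The level n + |i| of the definition only ensures that y_i survives. Any other such level gives
    the same entry: both are compared with the larger one, using that restriction commutes with
    d/dy_i. *)
Lemma jacobianE n N j i : (n <= N)%N -> - N%:Z <= i ->
  jacobian E m n j i =
  poly_dR (mrestrict (fun i => - n%:Z <= i) (mpartial i (Ecoef E j N))).
Proof.
move=> nN Ni; rewrite [LHS]truncate_poly_dR; apply: (congr1 (@poly_dR k)).
pose M := maxn N (n + `|i|)%N.
have H L : (n <= L)%N -> (L <= M)%N -> - L%:Z <= i ->
    mrestrict (fun i => - n%:Z <= i) (mpartial i (Ecoef E j L)) =
    mrestrict (fun i => - n%:Z <= i) (mpartial i (Ecoef E j M)).
  move=> nL LM Li; rewrite -[X in mrestrict _ (mpartial _ X) =
    _](Ecoef_restrict E j LM).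
  rewrite [X in mrestrict _ X = _](mpartial_mrestrict _ Li).
  exact: mrestrictW.
apply: etrans (esym (H N nN (leq_maxl _ _) Ni)).
by apply: H; rewrite ?leq_addr ?leq_maxr //; lia.
Qed.

(** E_j is already 0 at level [N]. This bound makes the differential of [cotangent_shift] well
    defined and continuous. *)
Lemma jacobian_eq0 n N j i : (n <= N)%N -> - N%:Z <= i -> j < - m N ->
  jacobian E m n j i = 0.
Proof.
move=> nN Ni jN; rewrite (jacobianE _ nN Ni) (admissible_vanish m_adm) //.
by rewrite !raddf0.
Qed.

Lemma A_jacobian n j i : A_ m n (jacobian E m n j i).
Proof.
rewrite (@jacobianE n (n + `|i|)%N) ?leq_addr //; last by lia.
by apply: A_poly_dR; exact: mrestrictW.
Qed.

Lemma jacobian_finite n N j : (n <= N)%N ->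
  exists r : seq int, forall i, - N%:Z <= i -> i \notin r -> jacobian E m n j i
    = 0.
Proof.
move=> nN; have [r _ Er] := malg_vars (Ecoef E j N); exists r => i Ni ir.
rewrite (jacobianE _ nN Ni) mpartial_eq0 ?raddf0 // => a /Er ar.
by apply: contra ir => /ar.
Qed.

Lemma A_d_int n f : A_ m n f -> A_ m n (d_int E n f).
Proof.
move=> /A_supported fA; apply/A_supported; apply: supported_sderivation => //.
move=> [[] [i|j]] //=; rewrite /level_gen /= ?andbF // => _;
  first exact: supported0.
by apply/A_supported; apply: A_poly_dR; exact: Ecoef_restrict.
Qed.

Lemma d_int0 n : d_int E n 0 = 0.
Proof. exact: sderivation0. Qed.

End Equation.

(** At the level [N], which contains y_i and y_l, both entries are second derivatives of
    [Ecoef D (-1) N]. *)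
Lemma jacobian_sym (D : diffalg k) n i l :
  jacobian (variational_derivative D) m n (-1 - i) l =
  jacobian (variational_derivative D) m n (-1 - l) i.
Proof.
pose N := (n + `|i| + `|l|)%N.
have nN : (n <= N)%N by rewrite /N -addnA leq_addr.
have Ni : - N%:Z <= i by rewrite /N; lia.
have Nl : - N%:Z <= l by rewrite /N; lia.
rewrite [LHS](jacobianE _ _ nN Nl) [RHS](jacobianE _ _ nN Ni).
apply: (congr1 (fun p => poly_dR (mrestrict _ p))).
rewrite [X in mpartial _ X = _](Ecoef_variational _ Ni).
by rewrite [X in _ = mpartial _ X](Ecoef_variational _ Nl) [LHS]mpartialC.
Qed.

End Levels.

(** * The residue form *)

Section AlternatingSum.
Context (V : zmodType) (I : Type) (F : I -> I -> V).
Hypotheses (F0 : forall i, F i i = 0) (FN : forall i j, F i j = - F j i).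

(** The diagonal has its own hypothesis because antisymmetry only gives 2 F i i = 0. Each step of
    the induction cancels one row against one column. *)
Lemma alternating_sum (r : seq I) : \sum_(i <- r) \sum_(j <- r) F i j = 0.
Proof.
elim: r => [|x r IH]; first by rewrite big_nil.
rewrite !big_cons F0 add0r; under [X in _ + X]eq_bigr do rewrite big_cons.
rewrite big_split /= IH addr0 -big_split big1 // => i _ /=.
by rewrite FN addNr.
Qed.

End AlternatingSum.

Definition dual v := match v with Yv i => Xiv (-1 - i) | Xiv j => Yv (-1 - j)
  end.
(** The index i of the term dy_i dxi_{-1-i} of the residue form in which dv occurs. *)
Definition pair_index v := match v with Yv i => i | Xiv j => -1 - j end.

Lemma dualK : involutive dual.
Proof. by case=> i /=; congr (_ _); ring. Qed.

Lemma eq_Yv i j : (Yv i == Yv j) = (i == j).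
Proof. by apply/eqP/eqP => [[]|->]. Qed.

Lemma eq_Xiv i j : (Xiv i == Xiv j) = (i == j).
Proof. by apply/eqP/eqP => [[]|->]. Qed.

Section ResidueForm.
Context (k : fieldType) (m : nat -> int).
Implicit Types (n N : nat) (i j : int) (v : dvar).
Local Notation mon := (smonom dR_odd).

(** The two conditions say -n <= i < m n, a window of length m n + n, empty if this number is
    negative. *)
Lemma residue_range n : exists2 s : seq int, uniq s &
  forall i, (i \in s) = in_level m n (Yv i) && in_level m n (Xiv (-1 - i)).
Proof.
exists [seq t%:Z - n%:Z | t <- iota 0 (absz (Num.max 0 (m n + n%:Z)))].
  by rewrite map_inj_uniq ?iota_uniq // => a b; lia.
move=> i; apply/mapP/andP => /= [[t]|[ni mi]].
  by rewrite mem_iota => tn ->; lia.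
by exists (absz (i + n%:Z)); rewrite ?mem_iota; lia.
Qed.

Definition residue_cm i : {cmonom dRgen} :=
  mmul (ucm (true, Yv i)) (ucm (true, Xiv (-1 - i))).

Lemma residue_cmE i v :
  residue_cm i (true, v) = (pair_index v == i).
Proof.
rewrite cmM !cmU; case: v => l /=; rewrite !xpair_eqE /=.
  by rewrite eq_Yv addn0 eq_sym.
rewrite eq_Xiv add0n; congr nat_of_bool; apply/eqP/eqP => [<-|<-]; ring.
Qed.

Lemma residue_cm_sqfree i : sqfree dR_odd (residue_cm i).
Proof.
apply/sqfreeP => -[[] v _]; first by rewrite residue_cmE leq_b1.
by rewrite cmM !cmU.
Qed.

Definition residue_mon i : mon :=
  exist (fun a => sqfree dR_odd a) _ (residue_cm_sqfree i).

(** dxi_j has even total degree, so no sign appears whatever the order of the generators. *)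
Lemma residue_monE i :
  dgen k (Yv i) * dgen k (Xiv (-1 - i)) = << residue_mon i >> :> dR k.
Proof.
rewrite -[X in << X *g residue_mon i >>]mulr1; apply: spUM_even => //.
by apply: (inversions_even _ _).2; rewrite mon_inU.
Qed.

Lemma residue_formE n (s : seq int) : uniq s ->
  (forall i, (i \in s) = in_level m n (Yv i) && in_level m n (Xiv (-1 - i))) ->
  residue_form k m n = \sum_(i <- s) (<< residue_mon i >> : dR k).
Proof.
move=> us sE; rewrite /residue_form (@fsbigE _ _ _ _ _ s) //; last 2 first.
- by move=> i /=; rewrite sE => /andP.
- by move=> i [Yi Xi]; rewrite sE Yi Xi.
rewrite big_seq_cond [RHS]big_seq; apply: eq_big => [i|i _];
  last exact: residue_monE.
apply: andb_idr => si; apply/mem_set.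
by move: si; rewrite sE => /andP[].
Qed.

Lemma lpartial_residue_mon i v :
  lpartial (true, v) (<< residue_mon i >> : dR k) =
  if pair_index v == i then dgen k (dual v) else 0.
Proof.
rewrite [LHS]lpartialU; case: ifPn => [/eqP vi|vi]; last first.
  by rewrite [X in _ *+ X]residue_cmE (negPf vi) mulr0n monalgU0.
rewrite [X in _ *+ X]residue_cmE vi eqxx mulr1n mul1r.
have E : smon_div (residue_mon i) (true, v) = smonU dR_odd (true, dual v).
  apply: val_inj; apply/eqP/cmP => g; rewrite /= divcmE /residue_cm -vi cmM
    !cmU.
  case: v {vi} => l /=; first by rewrite addKn.
  by rewrite (_ : -1 - (-1 - l) = l) ?addnK //; ring.
rewrite E; case: v {vi E} => l.
  rewrite (inversions_even _ _).2 //.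
  by rewrite mon_inU.
by rewrite (inversions_even _ _).1 // mon_inU.
Qed.

Lemma lpartial_residue_form n (s : seq int) v : uniq s ->
  (forall i, (i \in s) = in_level m n (Yv i) && in_level m n (Xiv (-1 - i))) ->
  lpartial (true, v) (residue_form k m n) =
  if pair_index v \in s then dgen k (dual v) else 0.
Proof.
move=> us sE; rewrite (residue_formE us sE) raddf_sum.
transitivity (\sum_(i <- s | i == pair_index v) dgen k (dual v)).
  rewrite [RHS]big_mkcond; apply: eq_bigr => i _; rewrite eq_sym.
  exact: lpartial_residue_mon.
case: ifPn => [vs|vs].
  by rewrite -big_filter (filter_pred1_uniq us vs) big_seq1.
by rewrite big_seq_cond big1 // => i /andP[si /eqP iv]; rewrite -iv si in vs.
Qed.

Lemma rpartial_dgen v u :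
  rpartial (true, v) (dgen k u) = if v == u then 1 else 0 :> dR k.
Proof.
have uv : ucm ((true, u) : dRgen) (true, v) = (v == u).
  by rewrite cmU xpair_eqE eq_sym.
rewrite [LHS]rpartialU [X in _ *+ X]uv; case: eqP => [<-|_]; last first.
  by rewrite mulr0n monalgU0.
have -> : smon_div (smonU dR_odd (true, v)) (true, v) = smon1 dR_odd.
  by apply: val_inj; apply/eqP/cmP => g; rewrite /= divcmE subnn cm1.
by rewrite [X in _ ^+ X](inversions1l dR_odd) mulr1.
Qed.

Lemma truncate1 n : truncate m n (1 : dR k) = 1.
Proof. by rewrite [LHS]truncateU /mon_level mdom1. Qed.

Section Admissible.
Context (E : diffalg k) (m_adm : admissible E m).

Lemma mem_residue_range n (s : seq int) v :
  (forall i, (i \in s) = in_level m n (Yv i) && in_level m n (Xiv (-1 - i))) ->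
  (pair_index v \in s) = in_level m n v && in_level m n (dual v).
Proof.
move=> sE; rewrite sE; case: v => [i|j] //; rewrite andbC.
by rewrite (_ : -1 - pair_index (Xiv j) = j) //=; ring.
Qed.

(** Ensures that [xget] in [form_coef] returns a level containing both generators; reaching xi_j
    uses that [m] is unbounded. *)
Lemma in_level_exists n v v' :
  exists N, [/\ (n <= N)%N, in_level m N v & in_level m N v'].
Proof.
have H u : exists N, in_level m N u.
  case: u => i; first by exists `|i|%N => /=; lia.
  by have [N iN] := level_exists m_adm (- i); exists N => /=; lia.
have [N Nv] := H v; have [N' Nv'] := H v'; exists (maxn n (maxn N N')).
split; first exact: leq_maxl.
  by apply: (in_levelW m_adm) Nv; rewrite !leq_max leqnn ?orbT.
by apply: (in_levelW m_adm) Nv'; rewrite !leq_max leqnn ?orbT.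
Qed.

Lemma form_coef_residue n v v' :
  form_coef m n (residue_form k m) v v' = if v' == dual v then 1 else 0.
Proof.
rewrite /form_coef; set N := xget _ _.
have [nN Nv Nv'] : [/\ (n <= N)%N, in_level m N v & in_level m N v'].
  exact: (xgetPex n (in_level_exists n v v')).
have [s us sE] := residue_range N.
rewrite (lpartial_residue_form v us sE) (mem_residue_range v sE) Nv /=.
case: ifPn => [_|Nd].
  rewrite [X in truncate _ _ X]rpartial_dgen; case: ifP => _;
    first exact: truncate1.
  exact: raddf0.
(* Here [dual v] is missing from the level [N], which contains [v']; hence they differ and both
   sides are 0. *)
have -> : (v' == dual v) = false by apply: contraNF Nd => /eqP <-.
by rewrite [X in truncate _ _ X]raddf0 raddf0.
Qed.

Lemma contraction_residue n (x : dvar -> dR k) :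
  contraction m n (residue_form k m) x = fun v => x (dual v).
Proof.
apply: funext => v; rewrite /contraction (@fsbigT_seq _ _ [:: dual v]) //.
  by rewrite big_seq1 form_coef_residue dualK eqxx mulr1.
move=> u; rewrite inE form_coef_residue => uv.
by rewrite ifN ?mulr0 //; apply: contra uv => /eqP->; rewrite dualK.
Qed.

Lemma residue_form_level n (a : mon) : a \in msupp (residue_form k m n) ->
  exists2 i, in_level m n (Yv i) && in_level m n (Xiv (-1 - i)) & a =
    residue_mon i.
Proof.
have [s us sE] := residue_range n; rewrite (residue_formE us sE) => as_.
have /hasP[i si ai] : has (fun i => a == residue_mon i) s.
  apply/negPn/negP => /hasPn sa; move: as_; rewrite -mcoeff_neq0 raddf_sum.
  rewrite big_seq big1 ?eqxx // => i /sa;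
    rewrite [in X in X -> _]eq_sym => /negPf ai.
  by rewrite [LHS]mcoeffU ai.
by exists i; rewrite -?sE //; apply/eqP.
Qed.

Lemma mon_level_residue n i : mon_level m n (residue_mon i) =
  in_level m n (Yv i) && in_level m n (Xiv (-1 - i)).
Proof. by rewrite -[LHS]/(mon_in _ (residue_cm i)) mon_inM !mon_inU. Qed.

Lemma residue_proform : proform m 2 (-1) (residue_form k m).
Proof.
split=> n; last first.
  have [s us sE] := residue_range n; have [s' us' sE'] := residue_range n.+1.
  rewrite (residue_formE us sE) (residue_formE us' sE') raddf_sum.
  transitivity (\sum_(i <- s' | i \in s) (<< residue_mon i >> : dR k)).
    rewrite [RHS]big_mkcond; apply: eq_bigr => i _.
    by rewrite [LHS]truncateU mon_level_residue -sE.
  rewrite -big_filter; apply: perm_big; apply: uniq_perm => [||i] //.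
    exact: filter_uniq.
  rewrite mem_filter; apply: andb_idr; rewrite sE sE' => /andP[Yi Xi].
  by rewrite !(in_levelW m_adm (leqnSn n)).
move=> a /residue_form_level[i li ->]; split;
  first by rewrite mon_level_residue.
  by rewrite -[LHS]/(mcount _ (residue_cm i)) mcountM !mcountU.
by rewrite -[LHS]/(- (mcount _ (residue_cm i))%:Z) mcountM !mcountU.
Qed.

(** The form has constant coefficients: only generators dv occur in it. *)
Lemma d_dR_residue n : d_dR (residue_form k m n) = 0.
Proof.
rewrite /d_dR (@sderivationE _ _ _ _ _ [::]) ?big_nil // => -[[] v] _;
  [by left|right].
apply: (@lpartial_eq0 _ _ _ (fun g => g.1)) => // a /residue_form_level[i _ ->].
by rewrite mon_inM !mon_inU.
Qed.

End Admissible.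

End ResidueForm.

(** * Closedness of the residue form *)

Section SandwichedProducts.
Context (A : nzRingType) (x y p : A).
Hypotheses (px : p * x = x * p) (py : p * y = y * p).

Lemma sandwich_anticomm : x * y = - (y * x) -> x * p * y = - (y * p * x).
Proof. by move=> xy; rewrite -!mulrA px py !mulrA xy mulNr. Qed.

Lemma sandwich_sqr : x * x = 0 -> x * p * x = 0.
Proof. by move=> xx; rewrite -mulrA px mulrA xx mul0r. Qed.

End SandwichedProducts.

Section Closedness.
Context (k : fieldType) (m : nat -> int) (D : diffalg k).
Context (m_adm : admissible (variational_derivative D) m).
Local Notation E := (variational_derivative D).

Lemma d_int_residue n : d_int E n (residue_form k m n) = 0.
Proof.
have [s us sE] := residue_range m n.
pose S := Ecoef D (-1) n; have [t _ St] := malg_vars S.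
(* The list contains the window and all variables of S, so that both indices of the Hessian can run
   over it. *)
pose r := undup (s ++ t).
have ur : uniq r by exact: undup_uniq.
have S0 i : i \notin r -> mpartial i S = 0.
  rewrite mem_undup mem_cat negb_or => /andP[_ ti];
    apply: mpartial_eq0 => a /St at_.
  by apply: contra ti; exact: at_.
have dS i : d_dR (poly_dR (mpartial i S)) =
    \sum_(l <- r) dgen k (Yv l) * poly_dR (mpartial l (mpartial i S)).
  apply: (d_dR_poly_dR ur) => l /S0 lS.
  by rewrite [LHS]mpartialC [X in mpartial _ X]lS [LHS]raddf0.
(* Only the dxi_{-1-i} of the window contribute: [d_int] kills dy_i, and neither y_i nor xi_j occurs
   in the form. *)
rewrite /d_int (@sderivationE _ _ _ _ _ [seq (true, Xiv (-1 - i)) | i <- s]);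
  last first.
- move=> [[] [i|j]] js; [by left|right|right|right].
  + rewrite [LHS](lpartial_residue_form k _ us sE) ifN //;
    apply: contra js => js.
    by apply/mapP; exists (-1 - j) => //; congr (_, Xiv _); ring.
  + apply: (@lpartial_eq0 _ _ _ (fun g => g.1)) => // a /residue_form_level[l _
    ->].
    by rewrite mon_inM !mon_inU.
  + apply: (@lpartial_eq0 _ _ _ (fun g => g.1)) => // a /residue_form_level[l _
    ->].
    by rewrite mon_inM !mon_inU.
- by rewrite map_inj_uniq // => i i' [] /addrI/oppr_inj.
rewrite big_map.
transitivity (\sum_(i <- s) - d_dR (poly_dR (mpartial i S)) * dgen k (Yv i)).
  apply: eq_big_seq => i si; move: (si); rewrite sE => /andP[/= ni _].
  rewrite [X in spmul _ X](lpartial_residue_form k _ us sE).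
  rewrite (_ : pair_index _ = i) ?si /=; last by rewrite /=; ring.
  rewrite (_ : -1 - (-1 - i) = i); last by ring.
  by rewrite [X in poly_dR X](Ecoef_variational _ ni).
(* Outside the window dS/dy_i is 0: for i >= m n it equals E_{-1-i}, which vanishes by
   admissibility, and for i < -n the variable y_i is absent. *)
transitivity (\sum_(i <- r) - d_dR (poly_dR (mpartial i S)) * dgen k (Yv i)).
  have rs i : i \in r -> i \notin s -> mpartial i S = 0.
    move=> _; rewrite sE /= negb_and -!ltNge.
    have [ni /= mi|ni _] := leP (- n%:Z) i.
      rewrite -[LHS](Ecoef_variational D ni).
      by apply: (admissible_vanish m_adm).
    rewrite -[S](Ecoef_restrict D (-1) (leqnn n)).
    by apply: mpartial_mrestrict0; rewrite -ltNge.
  rewrite [RHS](bigID (mem s)) /= [X in _ = _ + X]big_seq_cond.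
  rewrite [X in _ = _ + X]big1 ?addr0; last first.
    move=> i /andP[ir si]; rewrite (rs i ir si).
    rewrite [X in d_dR X]raddf0 [X in - X]sderivation0.
    by rewrite oppr0 mul0r.
  rewrite -[RHS]big_filter; apply: perm_big; apply: uniq_perm => [||i] //.
    exact: filter_uniq.
  by rewrite mem_filter /=; apply/esym/andb_idr => si;
    rewrite mem_undup mem_cat si.
transitivity (- \sum_(i <- r) \sum_(l <- r)
    dgen k (Yv l) * poly_dR (mpartial l (mpartial i S)) * dgen k (Yv i)).
  by rewrite -sumrN; apply: eq_bigr => i _; rewrite dS mulNr mulr_suml.
(* The Hessian entry is symmetric and commutes with the dy_i, which anticommute and have square
   0. *)
rewrite alternating_sum ?oppr0 // => [i|i l].
  by apply: sandwich_sqr; [apply: even_comm;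
    exact: poly_dR_even | exact: spvar_sqr].
rewrite [X in _ = - (_ * poly_dR X * _)]mpartialC; apply: sandwich_anticomm.
- by apply: even_comm; exact: poly_dR_even.
- by apply: even_comm; exact: poly_dR_even.
- exact: spvar_anticomm.
Qed.

Lemma residue_closed : closed_2form E m (strictly_closed (residue_form k m)).
Proof.
split=> [[|q]|n|[|q] n] /=.
- exact: (@residue_proform k m _ m_adm).
- split=> n; last exact: raddf0.
  by move=> a; rewrite msupp0.
- exact: d_int_residue.
- by rewrite d_int0 addr0; exact: d_dR_residue.
- by rewrite d_int0 addr0; exact: sderivation0.
Qed.

End Closedness.

(** * The cotangent complex is Tate *)

Definition box (B : nat) : seq dvar :=
  [seq Yv (t%:Z - B%:Z) | t <- iota 0 (B + B).+1] ++
  [seq Xiv (t%:Z - B%:Z) | t <- iota 0 (B + B).+1].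

Lemma mem_box B v : (v \in box B) = (`|idx v| <= B%:Z).
Proof.
rewrite mem_cat; apply/orP/idP => [[] /mapP[t]|vB]; rewrite ?mem_iota.
- by move=> tB -> /=; lia.
- by move=> tB -> /=; lia.
by case: v vB => i iB; [left|right]; apply/mapP;
  exists (absz (i + B%:Z)); move: iB; rewrite ?mem_iota /= => iB;
  [lia | congr Yv; lia | lia | congr Xiv; lia].
Qed.

Lemma finite_box (A : set dvar) (B : nat) :
  (forall v, A v -> `|idx v| <= B%:Z) -> finite_set A.
Proof.
move=> AB; apply: (@sub_finite_set _ _ [set` box B]); last exact: finite_seq.
by move=> v /AB; rewrite /= mem_box.
Qed.

Lemma finite_idx_bound (A : set dvar) : finite_set A ->
  exists B : nat, forall v, A v -> idx v < B%:Z.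
Proof.
move=> /finite_seqP[s ->]; elim: s => [|u s [B sB]]; first by exists 0%N.
exists (maxn B `|idx u|.+1) => v /=; rewrite inE => /orP[/eqP->|/sB]; lia.
Qed.

Section Forms.
Context (k : fieldType) (m : nat -> int).

Lemma is_form0 n w e : is_form m n w e (0 : dR k).
Proof. by move=> a; rewrite msupp0. Qed.

Lemma is_form1 n : is_form m n 0 0 (1 : dR k).
Proof.
move=> a /(fsubsetP msuppU_le); rewrite inE => /eqP->; split.
- by rewrite /mon_level mdom1; apply/allP.
- by rewrite /weight mdom1 big_mkcond big_seq_fset0.
- by rewrite /degree mdom1 big_mkcond big_seq_fset0.
Qed.

(** The zero homotopy works; the hypotheses on 0 make it a continuous linear map of degree -1. *)
Lemma homotopic_id_eq n (M : tdgmod k) F :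
  td_car M 0 -> (forall e, td_deg M e 0) -> (forall N, td_nbhd M N 0) ->
  td_diff M 0 = 0 -> (forall x, F x = x) -> homotopic_id m n M F.
Proof.
move=> M0 dM0 nM0 d0 FE; exists (fun=> 0); split; last first.
  by move=> x _; rewrite FE subrr d0 addr0.
split=> [x _|x y _ _|a x _ _|e x _ _|N'] //; first by rewrite addr0.
  by apply: funext => v; rewrite /td_scale mulr0.
by exists 0%N.
Qed.

End Forms.

Section Equation.
Context (k : fieldType) (m : nat -> int) (E : diffalg k).
Context (m_adm : admissible E m).
Local Notation L := (cotangent_shift E m).
Local Notation T := (tangent E m).
Implicit Types (x y : dvar -> dR k) (n N : nat) (v : dvar).

Lemma cotangent_car0 n : td_car (L n) 0.
Proof.
split=> [v|N]; first exact: A_0.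
by rewrite (_ : [set v | _] = set0) //; apply/seteqP; split=> // v [].
Qed.

Lemma tangent_car0 n : td_car (T n) 0.
Proof. by split=> [v|]; [exact: A_0 | exists 0%N]. Qed.

Lemma cotangent_diff0 n : td_diff (L n) 0 = 0.
Proof.
apply: funext => -[i|j] /=; rewrite d_int0 // fsbig1 ?subr0 // => j _.
by rewrite sgn_inv0 mul0r.
Qed.

Lemma tangent_diff0 n : td_diff (T n) 0 = 0.
Proof.
apply: funext => -[i|j] /=; rewrite d_int0 // fsbig1 ?subr0 // => i _.
by rewrite sgn_inv0 mul0r.
Qed.

(** The coordinate at dy_i collects the products of x at dxi_j with dE_j/dy_i. If xi_j is at level n
    + N the first factor is 0, otherwise E_j vanishes there. *)
Lemma cotangent_nbhd_diff n N x : td_nbhd (L n) N x ->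
  td_nbhd (L n) N (td_diff (L n) x).
Proof.
move=> xN [i|j] vN /=; rewrite (xN _ vN) d_int0 // fsbig1 ?subr0 // => j _.
have [Nj|jN] := leP (- m (n + N)%N) j; first by rewrite (xN (Xiv j)) //
  sgn_inv0 mul0r.
by rewrite (jacobian_eq0 m_adm (leq_addr N n) vN jN) mulr0.
Qed.

Lemma cotangent_car_diff n x : td_car (L n) x -> td_car (L n) (td_diff (L n) x).
Proof.
move=> [xA xfin]; split=> [[i|j] /=|N].
- apply: A_D; first exact: A_d_int.
  apply: A_N; apply: A_sum => j _; apply: A_M; last exact: A_jacobian.
  exact: A_sgn_inv.
- exact: A_d_int.
(* A new nonzero coordinate at dy_i with i >= -M comes from one of the finitely many xi_j of level
   [M] where x is nonzero, and each E_j involves finitely many y_i at that level. The maximum is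
   taken because [jacobian_eq0] needs a level above [n]. *)
pose M := maxn n N.
pose F v := [set u | exists i, [/\ u = Yv i, - M%:Z <= i & jacobian E m n (idx
  v) i <> 0]].
apply: (@sub_finite_set _ _ ([set v | in_level m N v /\ x v <> 0] `|`
  \bigcup_(v in [set v | in_level m M v /\ x v <> 0]) F v)); last first.
  rewrite finite_setU; split; first exact: xfin.
  apply: bigcup_finite; first exact: xfin.
  move=> v _; have [r rP] := @jacobian_finite _ m E n M (idx v) (leq_maxl _ _).
  apply: (@sub_finite_set _ _ [set` [seq Yv i | i <- r]]);
    last exact: finite_seq.
  move=> _ [i [-> Mi ji]] /=; apply/mapP; exists i => //.
  by apply: contrapT => /negP ir; apply: ji; exact: rP.
move=> v [vN dv]; have [xv|xv] := pselect (x v = 0); last by left.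
right; case: v vN dv xv => [i|j] /= vN; move=> + xv;
  rewrite xv d_int0 // sub0r => dv.
have [j xj] : exists j, sgn_inv (x (Xiv j)) * jacobian E m n j i <> 0.
  apply: contrapT => H; apply: dv; rewrite fsbig1 ?oppr0 // => j _.
  by apply: contrapT => Hj; apply: H; exists j.
have Mi : - M%:Z <= i by rewrite /M; lia.
exists (Xiv j); last by exists i; split=> // jj; apply: xj; rewrite jj mulr0.
split=> /=; last by move=> xj0; apply: xj; rewrite xj0 sgn_inv0 mul0r.
rewrite leNgt; apply/negP => jM; apply: xj.
by rewrite (jacobian_eq0 m_adm (leq_maxl n N) Mi jM) mulr0.
Qed.

Lemma cotangent_car_add n x y : td_car (L n) x -> td_car (L n) y ->
  td_car (L n) (x + y).
Proof.
move=> [xA xf] [yA yf]; split=> [v|N]; first exact: A_D.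
apply: (@sub_finite_set _ _ ([set v | in_level m N v /\ x v <> 0] `|`
  [set v | in_level m N v /\ y v <> 0])); last first.
  by rewrite finite_setU; split.
move=> v [vN xyv]; have [xv|xv] := pselect (x v = 0); last by left.
right; split=> // yv; apply: xyv.
by rewrite -[(x + y) v]/(x v + y v) xv yv addr0.
Qed.

Lemma cotangent_car_scale n a x : A_ m n a -> td_car (L n) x ->
  td_car (L n) (td_scale a x).
Proof.
move=> aA [xA xf]; split=> [v|N]; first exact: A_M.
apply: sub_finite_set (xf N) => v [vN av]; split=> // xv; apply: av.
by rewrite /td_scale xv mulr0.
Qed.

Definition basis_vector v : dvar -> dR k := fun u => if u == v then 1 else 0.

Lemma cotangent_car_basis n v : td_car (L n) (basis_vector v).
Proof.
split=> [u|N]; rewrite /basis_vector.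
  by case: ifP => _; [exact: A_1 | exact: A_0].
apply: (@sub_finite_set _ _ [set v]) => [u [_]|]; last exact: finite_set1.
by case: eqP.
Qed.

Lemma sum_basis (vs : seq dvar) (c : 'I_(size (map basis_vector vs)) -> dR k) u
  :
  (\sum_(i < size (map basis_vector vs)) td_scale (c i) (map basis_vector
    vs)`_i) u =
  \sum_(i < size (map basis_vector vs)) if nth u vs i == u then c i else 0.
Proof.
rewrite fct_sumE; apply: eq_bigr => i _; rewrite /td_scale.
rewrite (nth_map u) /basis_vector; last by rewrite -(size_map basis_vector).
by rewrite eq_sym; case: ifP; rewrite ?mulr1 ?mulr0.
Qed.

(** Modulo the [N]-th open submodule the lattice is free on the generators of level n + N that are
    not of level n, and these are finitely many. *)
Lemma cotangent_lattice n : lattice m n (L n) [set x | td_car (L n) x /\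
  td_nbhd (L n) 0 x].
Proof.
split.
- by move=> x [].
- by exists 0%N.
- move=> x y [xc x0] [yc y0]; split; first exact: cotangent_car_add.
  by move=> v v0; rewrite -[(x + y) v]/(x v + y v) x0 // y0 // addr0.
- move=> a x aA [xc x0]; split; first exact: cotangent_car_scale.
  by move=> v v0; rewrite /td_scale x0 // mulr0.
- by move=> x [xc x0]; split; [exact: cotangent_car_diff | exact:
  cotangent_nbhd_diff].
(* Bounds the indices of the basis: -n - N <= i < -n for y_i and -m (n + N) <= j < -m n for xi_j. *)
move=> N; pose B := (n + N + `|m (n + N)| + `|m n|)%N.
pose P v := in_level m (n + N)%N v && ~~ in_level m n v.
pose vs := undup [seq v <- box B | P v].
have vsE v : (v \in vs) = P v.
  rewrite mem_undup mem_filter; apply: andb_idr; rewrite mem_box /P /B.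
  by case: v => i /= /andP[]; lia.
pose s := map basis_vector vs.
have ss : size s = size vs by exact: size_map.
exists s; split=> [i|x [[xA xf] x0]].
  have ivs : (i < size vs)%N by rewrite -ss.
  pose v := nth (Yv 0) vs i.
  have vP : P v by rewrite -vsE mem_nth.
  rewrite (nth_map (Yv 0)) // -/v; split; last first.
    (* In L[-1] the generator dxi_j has degree 0 and dy_i degree 1. *)
    exists (~~ is_xi v)%:R => u; rewrite /basis_vector; case: eqP => [->|_].
      by case: (is_xi v); rewrite ?subrr; exact: is_form1.
    exact: is_form0.
  split; first exact: cotangent_car_basis.
  move=> u un; rewrite /basis_vector ifN //; apply: contraTN vP => /eqP <-.
  by rewrite /P -[in in_level m n u](addn0 n) un andbF.
have sumE (c : 'I_(size s) -> dR k) (i : 'I_(size s)) u : nth u vs i = u ->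
    (\sum_(i < size s) td_scale (c i) s`_i) u = c i.
  move=> iu; rewrite [LHS]sum_basis (bigD1 i) //= iu eqxx big1 ?addr0 // => i'
    ii'.
  rewrite ifN //; apply: contra ii' => /eqP i'u; apply/eqP/val_inj/eqP.
  rewrite -(nth_uniq u _ _ (undup_uniq _ : uniq vs)) -?ss ?ltn_ord //.
  by rewrite i'u iu.
(* The coefficients are the coordinates of [x] themselves; uniqueness follows by reading off each
   coordinate in [vs]. *)
exists (fun i => x (nth (Yv 0) vs i)); split=> [|c' [c'A c'N]].
  split=> [i|u uN]; first exact: xA.
  rewrite -[LHS]/(x u - (\sum_(i < size s) _) u).
  have [us|us] := boolP (u \in vs).
    have iu : (index u vs < size s)%N by rewrite ss index_mem.
    rewrite (sumE _ (Ordinal iu)) /= ?nth_index ?subrr //.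
  rewrite sum_basis big1 => [|i _]; last first.
    rewrite ifN //; apply: contra us => /eqP <-; rewrite mem_nth // -ss.
    exact: ltn_ord.
  rewrite subr0; apply: x0; rewrite addn0.
  by apply: contraNT us => un; rewrite vsE /P uN un.
apply: funext => i; pose u := nth (Yv 0) vs i.
have ivs : (i < size vs)%N by rewrite -ss.
have uP : P u by rewrite -vsE mem_nth.
have uN : in_level m (n + N)%N u by case/andP: uP.
have := c'N u uN; rewrite -[LHS]/(x u - (\sum_(i < size s) _) u).
rewrite (sumE _ i); last by rewrite /u; exact: set_nth_default.
by move/eqP; rewrite subr_eq0 => /eqP.
Qed.

Lemma cotangent_tate n : tate m n (L n).
Proof.
split=> [N x _|]; first exact: cotangent_nbhd_diff.
by exists [set x | td_car (L n) x /\ td_nbhd (L n) 0 x];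
  exact: cotangent_lattice.
Qed.

End Equation.

(** * Non-degeneracy *)

Section Duality.
Context (k : fieldType) (m : nat -> int) (D : diffalg k).
Context (m_adm : admissible (variational_derivative D) m).
Local Notation E := (variational_derivative D).
Local Notation L := (cotangent_shift E m).
Local Notation T := (tangent E m).
Implicit Types (x y : dvar -> dR k) (n N : nat) (v : dvar).

Definition dualize x : dvar -> dR k := fun v => x (dual v).

Lemma dualizeK x : dualize (dualize x) = x.
Proof. by apply: funext => v; rewrite /dualize dualK. Qed.

(** At dy_i the tangent side uses row -1 - i of the Jacobian and the cotangent side column i; the
    substitution j = -1 - l and [jacobian_sym] match them. *)
Lemma dualize_diff n x : dualize (td_diff (T n) x) = td_diff (L n) (dualize x).
Proof.
apply: funext => -[i|j]; last by [].
rewrite /dualize /=; apply: (congr1 (fun f => d_int E n (x (Xiv (-1 - i))) -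
  f)).
rewrite [RHS](reindex_fsbigT (fun l : int => -1 - l)) /=; last first.
  by exists (fun l : int => -1 - l) => l; ring.
apply: eq_fsbigr => l _; rewrite (jacobian_sym m D n i).
by rewrite (_ : -1 - (-1 - l) = l) //; ring.
Qed.

Lemma dualize_tangent n : cont_linear m n 0 (T n) (L n) dualize.
Proof.
split=> // [x [xA [M xM]]|e x _ xe v|N].
- split=> [v|N]; first exact: xA.
  (* Level [N] bounds the index of [v] from below, and level [M] for [dual v] bounds it from
     above. *)
  apply: (@finite_box _ (N + M + `|m N| + `|m M|)%N) => v [vN xv].
  have : in_level m M (dual v) by apply/negPn/negP => /xM.
  by case: v vN {xv} => i /=; lia.
- by move: (xe (dual v)); rewrite addr0; case: v.
- exists (n + N + `|m (n + N)%N|)%N => x _ xN v vN; apply: xN.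
  by case: v vN => i /=; lia.
Qed.

Lemma dualize_cotangent n : cont_linear m n 0 (L n) (T n) dualize.
Proof.
split=> // [x [xA xf]|e x _ xe v|N].
- split=> [v|]; first exact: xA.
  (* Level 0 suffices, since it contains all generators of large index. *)
  have [B xB] := finite_idx_bound (xf 0%N).
  have [M BM] := level_exists m_adm B%:Z.
  (* Outside this level, [dual v] has index at least [B]: through the summand [B] for y_i, and
     through [m] reaching [B] at [M] for xi_j. The summand from [m 0] puts [dual v] at level 0. *)
  exists (B + M + `|m 0|)%N => v vM; apply: contrapT => xv.
  have BM' : B%:Z <= m (B + M + `|m 0|)%N.
    by apply: le_trans BM (admissible_mono m_adm _); lia.
  have : idx (dual v) < B%:Z.
    by apply: xB; split=> //; case: v vM {xv} => i /=; lia.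
  by case: v vM {xv} => i /=; lia.
- by move: (xe (dual v)); rewrite addr0; case: v.
- have [M NM] := level_exists m_adm N%:Z; exists (N + M)%N => x _ xN v vN.
  apply: xN; have NM' : N%:Z <= m (n + (N + M))%N.
    by apply: le_trans NM (admissible_mono m_adm _); lia.
  by case: v vN => i /=; lia.
Qed.

Lemma residue_nondegenerate : Defs.nondegenerate E m (residue_form k m).
Proof.
move=> n; have -> : contraction m n (residue_form k m) = dualize.
  by apply: funext => x; exact: (contraction_residue m_adm).
split; first by split; [exact: dualize_tangent | move=> x _;
  exact: dualize_diff].
exists dualize; split.
- split=> [|x _]; first exact: dualize_cotangent.
  by rewrite -[x in td_diff _ x]dualizeK -dualize_diff dualizeK.
- apply: homotopic_id_eq => //; [exact: tangent_car0 | |exact: tangent_diff0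
  |exact: dualizeK].
  by move=> e v; exact: is_form0.
- apply: homotopic_id_eq => //; [exact: cotangent_car0 | |exact:
  cotangent_diff0 |exact: dualizeK].
  by move=> e v; exact: is_form0.
Qed.

End Duality.

(** Every admissible [m] gives a model of dSol, and [admissible_exists] provides one. *)
Theorem corollary3p2 (k : fieldType) (k_char0 : [pchar k] =i pred0)
    (D : diffalg k) (m : nat -> int)
    (m_adm : admissible (variational_derivative D) m) :
  tate_symplectic (variational_derivative D) m
    (strictly_closed (residue_form k m)).
Proof.
split; first by move=> n; exact: (cotangent_tate m_adm).
  exact: residue_closed.
exact: residue_nondegenerate.
Qed.
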